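(* Let $p$ be a prime. Let $P_{1}(t), \dots, P_{l}(t) \in \mathbb{Z}_{p}[t]$ be monic polynomials of degree at most $2$ whose images modulo $p$ are distinct and irreducible in $\mathbb{F}_{p}[t]$. For each $1 \le j \le l$, let $G_{j}$ be a finite module over $\mathbb{Z}_{p}[t]/(P_{j}(t))$. Then \[ \lim_{n \rightarrow \infty}\underset{X \in \mathrm{Mat}_{n}(\mathbb{Z}_{p})}{\mathrm{Prob}}\left( \mathrm{cok}(P_{j}(X)) \simeq G_{j} \text{ for all } 1 \leq j \leq l \right) = \prod_{j=1}^{l}\frac{1}{|\mathrm{Aut}_{\mathbb{Z}_{p}[t]/(P_{j}(t))}(G_{j})|}\prod_{i=1}^{\infty}\big(1 - p^{-i\deg(P_{j})}\big). \]
   Context: $\mathbb{Z}_p$ denotes the $p$-adic integers and $\mathrm{Mat}_n(\mathbb{Z}_p)$ the $n\times n$ matrices over it; the probability is with respect to the Haar probability measure on the additive compact group $\mathrm{Mat}_n(\mathbb{Z}_p)\cong\mathbb{Z}_p^{n^2}$. For a matrix $Y\in\mathrm{Mat}_n(\mathbb{Z}_p)$, $\mathrm{cok}(Y)=\mathbb{Z}_p^n/Y\mathbb{Z}_p^n$. For $X \in \mathrm{Mat}_n(\mathbb{Z}_p)$, $\mathrm{cok}(P_j(X))$ is a $\mathbb{Z}_{p}[t]/(P_{j}(t))$-module with $\bar t$ acting by left multiplication by $X$; isomorphism is as $\mathbb{Z}_{p}[t]/(P_{j}(t))$-modules (equivalently, as abelian groups). $\mathrm{Aut}_R(G)$ denotes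 the group of $R$-linear automorphisms of $G$. *)

(* Defs.v *)
From HB Require Import structures.
From mathcomp Require Import all_boot all_order all_algebra.
From mathcomp Require Import intdiv.
From mathcomp Require Import all_classical all_reals all_analysis.
Set Implicit Arguments. Unset Strict Implicit. Unset Printing Implicit Defensive.
Import Order.TTheory GRing.Theory Num.Theory.
Local Open Scope classical_set_scope.
Local Open Scope ring_scope.

(* The p-adic integers Z_p, as the inverse limit of the rings Z/p^k Z.      *)
(* An element is a compatible sequence of residues (x_k)_k with             *)
(* 0 <= x_k < p^k and x_{k+1} = x_k mod p^k (we use the base maxn p 2,       *)
(* following the convention of 'Z_p / 'F_p in MathComp; it equals p         *)
(* whenever p is prime).  Ring operations are componentwise mod p^k.        *)

Definition zp_base (p : nat) : nat := maxn p 2.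
Definition zp_mod (p k : nat) : int := ((zp_base p) ^ k)%N%:Z.
Definition zp_compat (p : nat) (f : nat -> int) : bool :=
  `[< forall k, f k = (f k.+1 %% zp_mod p k)%Z >].

Record Zpadic (p : nat) := ZpMk { zpval : nat -> int ; zpvalP : zp_compat p zpval }.

Section ZpRing.
Variable p : nat.
Local Notation M := (zp_mod p).
HB.instance Definition _ := [isSub for @zpval p].
HB.instance Definition _ := [Choice of Zpadic p by <:].

Lemma zp_modS k : (M k %| M k.+1)%Z.
Proof. by rewrite /zp_mod expnS PoszM dvdz_mull. Qed.

Lemma modz_modS (a : int) k : modz (modz a (M k.+1)) (M k) = modz a (M k).
Proof.
rewrite {2}(divz_eq a (M k.+1)).
have [c ->] := dvdzP (zp_modS k).
by rewrite mulrA modzMDl.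
Qed.

Lemma compatP (f : nat -> int) : reflect (forall k, f k = (f k.+1 %% M k)%Z) (zp_compat p f).
Proof. exact: asboolP. Qed.

Lemma zp_red (x : Zpadic p) k : (zpval x k %% M k)%Z = zpval x k.
Proof. by have /compatP h := zpvalP x; rewrite h modz_mod. Qed.

Lemma mk_compat (g : nat -> int) : zp_compat p (fun k => (g k %% M k)%Z) ->
  zp_compat p (fun k => (g k %% M k)%Z).
Proof. by []. Qed.

Lemma compat_op (f : nat -> int) :
  (forall k, (f k.+1 %% M k)%Z = (f k %% M k)%Z) ->
  zp_compat p (fun k => (f k %% M k)%Z).
Proof. by move=> h; apply/compatP => k; rewrite modz_modS h. Qed.

Definition zp0 : Zpadic p := @ZpMk p (fun k => (0 %% M k)%Z) (@compat_op (fun _ => _) (fun k => erefl)).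
Definition zp1 : Zpadic p := @ZpMk p (fun k => (1 %% M k)%Z) (@compat_op (fun _ => _) (fun k => erefl)).

Lemma addP (x y : Zpadic p) k :
  ((zpval x k.+1 + zpval y k.+1) %% M k)%Z = ((zpval x k + zpval y k) %% M k)%Z.
Proof.
have /compatP hx := zpvalP x; have /compatP hy := zpvalP y.
by rewrite -modzDml -modzDmr -hx -hy.
Qed.
Lemma mulP (x y : Zpadic p) k :
  ((zpval x k.+1 * zpval y k.+1) %% M k)%Z = ((zpval x k * zpval y k) %% M k)%Z.
Proof.
have /compatP hx := zpvalP x; have /compatP hy := zpvalP y.
by rewrite -modzMml -modzMmr -hx -hy.
Qed.
Lemma oppP (x : Zpadic p) k :
  ((- zpval x k.+1) %% M k)%Z = ((- zpval x k) %% M k)%Z.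
Proof. by have /compatP hx := zpvalP x; rewrite -modzNm -hx. Qed.

Definition zp_add (x y : Zpadic p) : Zpadic p := ZpMk (compat_op (addP x y)).
Definition zp_mul (x y : Zpadic p) : Zpadic p := ZpMk (compat_op (mulP x y)).
Definition zp_opp (x : Zpadic p) : Zpadic p := ZpMk (compat_op (oppP x)).

Lemma zp_eq (x y : Zpadic p) : (forall k, zpval x k = zpval y k) -> x = y.
Proof. by move=> h; apply: val_inj; apply: funext. Qed.

Lemma zp_addA : associative zp_add.
Proof. by move=> x y z; apply: zp_eq => k /=; rewrite modzDml modzDmr addrA. Qed.
Lemma zp_addC : commutative zp_add.
Proof. by move=> x y; apply: zp_eq => k /=; rewrite addrC. Qed.
Lemma zp_add0 : left_id zp0 zp_add.
Proof. by move=> x; apply: zp_eq => k /=; rewrite modzDml add0r zp_red. Qed.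
Lemma zp_addN : left_inverse zp0 zp_opp zp_add.
Proof. by move=> x; apply: zp_eq => k /=; rewrite modzDml addNr. Qed.

HB.instance Definition _ := GRing.isZmodule.Build (Zpadic p) zp_addA zp_addC zp_add0 zp_addN.

Lemma zp_mulA : associative zp_mul.
Proof. by move=> x y z; apply: zp_eq => k /=; rewrite modzMml modzMmr mulrA. Qed.
Lemma zp_mulC : commutative zp_mul.
Proof. by move=> x y; apply: zp_eq => k /=; rewrite mulrC. Qed.
Lemma zp_mul1 : left_id zp1 zp_mul.
Proof. by move=> x; apply: zp_eq => k /=; rewrite modzMml mul1r zp_red. Qed.
Lemma zp_mulDl : left_distributive zp_mul zp_add.
Proof.
move=> x y z; apply: zp_eq => k /=.
by rewrite modzMml mulrDl modzDm.
Qed.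
Lemma zp_one_neq0 : zp1 != zp0.
Proof.
apply/eqP => /(congr1 (fun x => zpval x 1)) /=.
rewrite /zp_mod expn1 mod0z modz_small //.
by rewrite /zp_base ler01 /= ltz_nat leq_maxr.
Qed.

HB.instance Definition _ := GRing.Zmodule_isComNzRing.Build (Zpadic p)
  zp_mulA zp_mulC zp_mul1 zp_mulDl zp_one_neq0.
End ZpRing.


Definition zp_to_Fp (p : nat) (x : Zpadic p) : 'F_p := (zpval x 1)%:~R.

(* The sigma-algebra on Mat_n(Z_p) is generated by the cylinder sets        *)
(* {X | X = A mod p^k}; these form a countable base of clopen sets of the   *)
(* p-adic topology, so this is the Borel sigma-algebra.                     *)
Definition mx_trunc (p n k : nat) (X : 'M[Zpadic p]_n) : 'M[int]_n :=
  map_mx (fun x => zpval x k) X.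

Definition zp_cylinders (p n : nat) : set (set 'M[Zpadic p]_n) :=
  [set E | exists k (A : 'M[int]_n), E = mx_trunc k @^-1` [set A]].

HB.instance Definition _ (p : nat) := isPointed.Build (Zpadic p) 0.

Notation MatZp p n := (g_sigma_algebraType (@zp_cylinders p n)).

Definition is_haar (R : realType) (p n : nat) (mu : probability (MatZp p n) R) : Prop :=
  forall (X : 'M[Zpadic p]_n) (E : set (MatZp p n)), measurable E ->
    mu [set (X + (Y : 'M[Zpadic p]_n) : MatZp p n) | Y in E] = mu E.

(* cok(Y) = Z_p^n / Y Z_p^n, with t acting by left multiplication by X,     *)
(* is isomorphic (as a Z_p[t]-module) to G: there is a surjective           *)
(* Z_p[t]-linear map Z_p^n -> G whose kernel is exactly Y Z_p^n.            *)
Definition cok_iso (p n : nat) (X Y : 'M[Zpadic p]_n) (G : lmodType {poly Zpadic p}) : Prop :=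
  exists phi : 'cV[Zpadic p]_n -> G,
    [/\ forall (a : Zpadic p) (u v : 'cV[Zpadic p]_n), phi (a *: u + v) = a%:P *: phi u + phi v,
        forall v, phi (X *m v) = 'X *: phi v,
        forall g : G, exists v, phi v = g
      & forall v, phi v = 0 <-> exists w, v = Y *m w].

Definition is_lin_aut (R : nzRingType) (G : lmodType R) (f : G -> G) : Prop :=
  bijective f /\ forall (a : R) (u v : G), f (a *: u + v) = a *: f u + f v.

Definition card_Aut (R : nzRingType) (G : finLmodType R) : nat :=
  #|[set f : {ffun G -> G} | `[< is_lin_aut f >] ]|.

Definition inf_prod (R : realType) (q d : nat) : R :=
  limn (fun N : nat => \prod_(1 <= i < N.+1) (1 - (q%:R : R) ^- (i * d))).

(* Main.v *)
Require Import Defs.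
From HB Require Import structures.
From mathcomp Require Import all_boot all_order all_algebra.
From mathcomp Require Import all_classical all_reals all_analysis.
From mathcomp Require Import fingroup cyclic qpoly qfpoly.
From mathcomp Require Import ring lra.
Import Order.TTheory GRing.Theory Num.Theory.
Local Open Scope classical_set_scope.
Local Open Scope ring_scope.

(* With S_j = Z_p[t]/(P_j), the module cok(P_j(X)) is cok(X - t) over S_j. Fix onto Z_p-linear maps
   F_j : Z_p^n -> G_j, let L_j be the kernel of the induced S_j^n -> G_j, and choose a square
   matrix Lam_j with L_j = Lam_j S_j^n. The F_j induce isomorphisms cok(P_j(X)) -> G_j exactly
   when X - t = Lam_j A_j with A_j invertible modulo p, and each X whose cokernels are the G_j
   admits prod_j |Aut G_j| such families F. Over the residue field of size q, invertibility of A is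
   detected by inclusion-exclusion over the full-rank k x n matrices B with B A = 0, weighted by
   (-1)^k / prod_(1 <= i <= k) (q^i - 1). For fixed F and B = (B_j) the conditions "Lam_j divides
   X - t and B_j A_j = 0 for all j" have probability exactly prod_j |G_j|^-n q_j^(-n k_j) when the
   maps Z_p^n -> prod_j G_j and ker F -> prod_j F_(q_j)^(k_j) are onto, and 0 otherwise. If they
   were always onto, the sum over F and B would be prod_j |GL_n(F_(q_j))| / q_j^(n^2), whose
   limit is prod_j prod_i (1 - q_j^-i); the exceptional F and B contribute a vanishing amount. *)

Set Implicit Arguments. Unset Strict Implicit. Unset Printing Implicit Defensive.

(** * Arithmetic of the p-adic integers *)

(** The obstacle is that one matrix X over Z_p carries the conditions over all the rings S_j at
    once. As the P_j are distinct and irreducible modulo p, there are polynomials E_j equal to 1 in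
    S_j and to 0 in every other S_i, and the matrices E_j(X) glue solutions found for separate j.
    Hence a single X that meets the conditions for onto F_j and full-rank B_j already forces the
    joint maps to be onto, which is why the probability is 0 otherwise. When they are onto,
    translates of the event tile the matrix space, which gives the exact value. The exceptional F
    are exponentially rare in n. For B the difficulty is that ker F varies with F and that k_j is
    unbounded: the proof finds about n/s vectors in ker F, with s independent of n, and a left
    inverse over Z_p, so that a random B takes uniform values on them; large k_j are absorbed by the
    decay of the weights, whose sum against q^k is at most 9 for all n and q. If p^e kills every
    G_j, all events depend only on X modulo p^(e+1), so Haar measure enters only through the
    equidistribution of residue matrices. *)

Section PadicIntegers.
Variables (p : nat) (p_prime : prime p).
Local Notation Zp := (Zpadic p).

Lemma zp_modE k : zp_mod p k = (p ^ k)%N%:Z.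
Proof. by rewrite /zp_mod /zp_base (maxn_idPl (prime_gt1 p_prime)). Qed.

Lemma zp_mod_gt0 k : 0 < zp_mod p k.
Proof. by rewrite zp_modE ltz_nat expn_gt0 prime_gt0. Qed.

Lemma zp_mod_neq0 k : zp_mod p k != 0.
Proof. by rewrite gt_eqF ?zp_mod_gt0. Qed.

Lemma zpvalD (x y : Zp) k : zpval (x + y) k = ((zpval x k + zpval y k) %% zp_mod p k)%Z.
Proof. by []. Qed.

Lemma zpvalM (x y : Zp) k : zpval (x * y) k = ((zpval x k * zpval y k) %% zp_mod p k)%Z.
Proof. by []. Qed.

Lemma zpvalN (x : Zp) k : zpval (- x) k = ((- zpval x k) %% zp_mod p k)%Z.
Proof. by []. Qed.

Lemma zpval0 k : zpval (0 : Zp) k = 0.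
Proof. by rewrite /= mod0z. Qed.

Lemma zpval1 k : zpval (1 : Zp) k = (1 %% zp_mod p k)%Z.
Proof. by []. Qed.

Lemma zpval_natr m k : zpval (m%:R : Zp) k = (m%:Z %% zp_mod p k)%Z.
Proof.
elim: m => [|m IH]; first by rewrite zpval0 mod0z.
by rewrite -addn1 natrD zpvalD IH zpval1 modzDm.
Qed.

Lemma zpvalB (x y : Zp) k : zpval (x - y) k = ((zpval x k - zpval y k) %% zp_mod p k)%Z.
Proof. by rewrite zpvalD zpvalN modzDmr. Qed.

Lemma zpval_bound (x : Zp) k : 0 <= zpval x k < zp_mod p k.
Proof.
by rewrite -zp_red modz_ge0 ?ltz_pmod ?zp_mod_gt0 ?zp_mod_neq0.
Qed.

Lemma zpval_ge0 (x : Zp) k : 0 <= zpval x k.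
Proof. by case/andP: (zpval_bound x k). Qed.

Lemma zpval_trunc (x : Zp) k i : zpval x k = (zpval x (k + i) %% zp_mod p k)%Z.
Proof.
elim: i => [|i IH]; first by rewrite addn0 zp_red.
have /compatP hx := zpvalP x.
rewrite IH addnS (hx (k + i)%N) !zp_modE expnD PoszM.
set y := zpval _ _; set a := Posz _; set b := Posz _.
rewrite {2}(divz_eq y (a * b)) mulrCA [a * (_ * _)]mulrC.
by rewrite modzMDl.
Qed.

Lemma zp_divP (x : Zp) k : zpval x k = 0 -> exists y : Zp, x = (p ^ k)%:R * y.
Proof.
move=> xk0.
have dvd i : (zp_mod p k %| zpval x (i + k))%Z.
  by apply/dvdz_mod0P; rewrite addnC -zpval_trunc.
have modD i : zp_mod p (i + k) = zp_mod p i * zp_mod p k.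
  by rewrite !zp_modE expnD PoszM.
have hg : zp_compat p (fun i => (zpval x (i + k) %/ zp_mod p k)%Z).
  apply/compatP => i.
  have /compatP /(_ (i + k)%N) hx := zpvalP x.
  apply: (mulIf (zp_mod_neq0 k)); rewrite divzK // hx modD -addSn.
  have := divzK (dvd i.+1).
  move: (zpval _ _ %/ _)%Z => z <-.
  by rewrite /modz (divzMpr (zp_mod_gt0 k)) mulrBl mulrA.
exists (ZpMk hg); apply: zp_eq => i.
rewrite zpvalM zpval_natr -zp_modE modzMml /= mulrC divzK ?dvd //.
by rewrite -zpval_trunc.
Qed.

Lemma zpval_expM (y : Zp) k : zpval ((p ^ k)%:R * y) k = 0.
Proof. by rewrite zpvalM zpval_natr -zp_modE modzz mul0r mod0z. Qed.

Lemma zp_reg (y : Zp) : p%:R * y = 0 -> y = 0.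
Proof.
move=> h; apply: zp_eq => i; rewrite zpval0.
have := congr1 (fun z => zpval z i.+1) h.
rewrite /= -/(zpval (p%:R : Zp) i.+1) zpval_natr mod0z modzMml => /dvdz_mod0P.
rewrite zp_modE expnS PoszM dvdz_mul2l; last first.
  by rewrite eqz_nat -lt0n prime_gt0.
rewrite -zp_modE (zpval_trunc y i 1) addn1 => /dvdz_mod0P //.
Qed.

Lemma zp_approx (x : Zp) k : exists y : Zp, x = (`|zpval x k|%N)%:R + (p ^ k)%:R * y.
Proof.
have [|y hy] := @zp_divP (x - (`|zpval x k|%N)%:R) k.
  by rewrite zpvalB zpval_natr gez0_abs ?zpval_ge0 // zp_red subrr mod0z.
by exists y; rewrite -hy addrC subrK.
Qed.

Lemma zp_unitP (x : Zp) : zpval x 1 != 0 -> exists y : Zp, x * y = 1.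
Proof.
move=> x1.
have cop k : coprimez (zpval x k) (zp_mod p k).
  rewrite zp_modE coprimezE absz_nat; case: k => [|k]; first by rewrite expn0 coprimen1.
  rewrite coprimeXr // coprime_sym prime_coprime //.
  apply: contra x1 => dv; rewrite (zpval_trunc x 1 k) add1n.
  by apply/eqP/dvdz_mod0P; rewrite zp_modE expn1 dvdzE absz_nat.
pose g k := (egcdz (zpval x k) (zp_mod p k)).1.
have gP k : ((g k * zpval x k) %% zp_mod p k)%Z = (1 %% zp_mod p k)%Z.
  rewrite /g; case: egcdzP => u v + _ /=.
  by move/eqP: (cop k) => -> <-; rewrite [in RHS]addrC modzMDl.
have hg : zp_compat p (fun k => (g k %% zp_mod p k)%Z).
  apply: compat_op => k.
  have /compatP /(_ k) hx := zpvalP x.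
  have h1 : ((g k.+1 * zpval x k) %% zp_mod p k)%Z = (1 %% zp_mod p k)%Z.
    by rewrite hx modzMmr -(modz_modS p) gP modz_modS.
  (* Both Bezout coefficients invert [x] modulo p^k; evaluating g_(k+1) g_k x in two ways shows that
     they agree there. *)
  have : ((g k.+1 * (g k * zpval x k)) %% zp_mod p k =
      (g k * (g k.+1 * zpval x k)) %% zp_mod p k)%Z.
    by rewrite mulrCA.
  by rewrite -modzMmr gP modzMmr mulr1 -[in RHS]modzMmr h1 modzMmr mulr1.
exists (ZpMk hg); apply: zp_eq => k.
by rewrite zpvalM /= modzMmr mulrC gP.
Qed.

Lemma intr_zp_mod1 (a : int) : ((a %% zp_mod p 1)%Z)%:~R = a%:~R :> 'F_p.
Proof.
rewrite /modz rmorphB /= intrM [X in _ * X](_ : _ = 0) ?mulr0 ?subr0 //.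
by rewrite zp_modE expn1 -pmulrn pchar_Fp_0.
Qed.

Lemma zp_to_Fp_is_zmod_morphism : zmod_morphism (@zp_to_Fp p).
Proof. by move=> x y; rewrite /zp_to_Fp zpvalB intr_zp_mod1 rmorphB. Qed.

Lemma zp_to_Fp_is_monoid_morphism : monoid_morphism (@zp_to_Fp p).
Proof.
split; first by rewrite /zp_to_Fp zpval1 intr_zp_mod1.
by move=> x y; rewrite /zp_to_Fp zpvalM intr_zp_mod1 intrM.
Qed.

Lemma zp_to_Fp_eq0 (x : Zp) : zp_to_Fp x = 0 -> zpval x 1 = 0.
Proof.
rewrite /zp_to_Fp => h.
have /andP[x0 xp] := zpval_bound x 1.
move: h xp; rewrite -(gez0_abs x0) zp_modE expn1 ltz_nat -pmulrn => h xp.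
have := congr1 (@nat_of_ord _) h.
by rewrite val_Fp_nat //= modn_small // => ->.
Qed.

End PadicIntegers.

(** * Residue rings Z_p[t]/(P) *)

(* [Z_p[t]/(P)], with quotient map [ur_ev] and reduction [ur_red] modulo [p]. *)
Record unramified (p : nat) (P : {poly Zpadic p}) := Unramified {
  ur_ring : comNzRingType;
  ur_field : finFieldType;
  ur_ev : {rmorphism {poly Zpadic p} -> ur_ring};
  ur_red : {rmorphism ur_ring -> ur_field};
  ur_ev_surj : forall s : ur_ring, exists f, ur_ev f = s;
  ur_ev_eq0 : forall f : {poly Zpadic p}, ur_ev f = 0 <-> exists g : {poly Zpadic p}, f = P * g;
  ur_red_surj : forall a : ur_field, exists s : ur_ring, ur_red s = a;
  ur_red_eq0 : forall s : ur_ring, ur_red s = 0 -> exists s', s = p%:R * s';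
  ur_red_p : ur_red p%:R = 0;
  ur_reg : forall s : ur_ring, p%:R * s = 0 -> s = 0;
  ur_unit : forall s : ur_ring, ur_red s <> 0 -> exists s', s * s' = 1;
  ur_evE : forall f : {poly Zpadic p}, ur_red (ur_ev f) = 0 <->
             (map_poly (@zp_to_Fp p) P %| map_poly (@zp_to_Fp p) f)%R;
  ur_card : #|ur_field| = (p ^ (size P).-1)%N }.

Section Residue.
Import Pdiv.CommonRing Pdiv.RingMonic.
Variables (p : nat) (p_prime : prime p).
Local Notation Zp := (Zpadic p).
HB.instance Definition _ :=
  GRing.isZmodMorphism.Build Zp 'F_p (@zp_to_Fp p) (zp_to_Fp_is_zmod_morphism p_prime).
HB.instance Definition _ :=
  GRing.isMonoidMorphism.Build Zp 'F_p (@zp_to_Fp p) (zp_to_Fp_is_monoid_morphism p_prime).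

Lemma zp_to_Fp_surj (a : 'F_p) : exists x : Zp, zp_to_Fp x = a.
Proof. by exists (nat_of_ord a)%:R; rewrite rmorph_nat natr_Zp. Qed.

Variable P : {poly Zp}.
Hypothesis P_monic : P \is monic.
Local Notation Pb := (map_poly (@zp_to_Fp p) P).
Hypothesis P_irr : irreducible_poly Pb.

Lemma monic_Pb : Pb \is monic.
Proof. exact: monic_map. Qed.

Lemma size_Pb : size Pb = size P.
Proof.
rewrite size_poly_eq // -/(lead_coef P) (monicP P_monic) rmorph1; exact: oner_neq0.
Qed.

Lemma size_P_gt1 : (1 < size P)%N.
Proof. by rewrite -size_Pb; case: P_irr. Qed.

Lemma mi_Pb : monic_irreducible_poly Pb.
Proof. by split => //; exact: monic_Pb. Qed.

Local Notation S := {poly %/ P}.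
Local Notation F := {poly %/ Pb with mi_Pb}.

Lemma mk_monic_P : mk_monic P = P.
Proof. by rewrite /mk_monic size_P_gt1 P_monic. Qed.

Lemma size_qpolyP (s : S) : (size (val s) < size P)%N.
Proof. by apply: leq_trans (size_mk_monic s) _; rewrite mk_monic_P. Qed.

Lemma in_qpolyE f : val (in_qpoly P f) = rmodp f P.
Proof. by rewrite /= mk_monic_P. Qed.

Lemma in_qpoly_val (s : S) : in_qpoly P (val s) = s.
Proof. by apply: val_inj; exact: (in_qpoly_small (size_mk_monic _)). Qed.

Lemma in_qpoly_eq0 f : in_qpoly P f = 0 <-> exists g : {poly Zpadic p}, f = P * g.
Proof.
split=> [/(congr1 val)|[g ->]].
  rewrite /= mk_monic_P => f0; exists (rdivp f P).
  by rewrite [LHS](rdivp_eq P_monic) f0 addr0 mulrC.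
by apply: val_inj; rewrite /= mk_monic_P mulrC rmodp_mull.
Qed.

Definition res_poly (f : {poly Zp}) : F := in_qpoly Pb (map_poly (@zp_to_Fp p) f).

Lemma res_poly_zmod : zmod_morphism res_poly.
Proof. by move=> f g; rewrite /res_poly !rmorphB. Qed.

Lemma res_poly_monoid : monoid_morphism res_poly.
Proof.
split; first by rewrite /res_poly rmorph1 in_qpoly1.
by move=> f g; rewrite /res_poly rmorphM in_qpolyM.
Qed.

HB.instance Definition _ := GRing.isZmodMorphism.Build {poly Zp} F res_poly res_poly_zmod.
HB.instance Definition _ := GRing.isMonoidMorphism.Build {poly Zp} F res_poly res_poly_monoid.

Lemma res_poly_eq0 f : res_poly f = 0 <-> (Pb %| map_poly (@zp_to_Fp p) f)%R.
Proof.
split=> [/(congr1 val)|/dvdpP[g hg]].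
  rewrite /= (mk_monicE mi_Pb) => h.
  by rewrite [X in _ %| X](rdivp_eq monic_Pb) h addr0 dvdp_mull.
by apply: val_inj; rewrite /= (mk_monicE mi_Pb) hg rmodp_mull // monic_Pb.
Qed.

Definition res_red (s : S) : F := res_poly (val s).

Lemma res_red_in f : res_red (in_qpoly P f) = res_poly f.
Proof.
rewrite /res_red in_qpolyE; apply/eqP; rewrite eq_sym -subr_eq0 -rmorphB; apply/eqP.
rewrite res_poly_eq0 [X in X - _](rdivp_eq P_monic) addrK rmorphM /=.
exact: dvdp_mull.
Qed.

Lemma res_red_zmod : zmod_morphism res_red.
Proof. by move=> s t; rewrite -[s]in_qpoly_val -[t]in_qpoly_val -rmorphB !res_red_in rmorphB. Qed.

Lemma res_red_monoid : monoid_morphism res_red.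
Proof.
split; first by rewrite -(in_qpoly1 P) res_red_in rmorph1.
by move=> s t; rewrite -[s]in_qpoly_val -[t]in_qpoly_val -in_qpolyM !res_red_in rmorphM.
Qed.

HB.instance Definition _ := GRing.isZmodMorphism.Build S F res_red res_red_zmod.
HB.instance Definition _ := GRing.isMonoidMorphism.Build S F res_red res_red_monoid.

Lemma res_red_surj (a : F) : exists s, res_red s = a.
Proof.
pose c (x : 'F_p) : Zp := xget 0 [set y | zp_to_Fp y = x].
have cP x : zp_to_Fp (c x) = x.
  by have [y hy] := zp_to_Fp_surj x; rewrite /c; case: xgetP => // /(_ y).
pose a' : {poly %/ Pb} := a.
pose f := \poly_(i < size (val a')) c (val a')`_i.
exists (in_qpoly P f); rewrite res_red_in /res_poly.
have -> : map_poly (@zp_to_Fp p) f = val a'.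
  apply/polyP => i; rewrite coef_map coef_poly; case: ltnP => // h; first exact: cP.
  by rewrite raddf0 nth_default.
by apply: val_inj; exact: (in_qpoly_small (size_mk_monic _)).
Qed.

Lemma res_red_eq0 s : res_red s = 0 -> exists s', s = p%:R * s'.
Proof.
move=> h.
(* The representative has degree below that of [P], so its reduction is its own remainder modulo
   [Pb] and must vanish coefficientwise. *)
have m0 : map_poly (@zp_to_Fp p) (val s) = 0.
  rewrite -(@in_qpoly_small _ Pb (map_poly (@zp_to_Fp p) (val s))); last first.
    rewrite (mk_monicE mi_Pb) size_Pb.
    exact: leq_ltn_trans (size_poly _ _) (size_qpolyP s).
  have h' : in_qpoly Pb (map_poly (@zp_to_Fp p) (val s)) = 0 := h.
  by rewrite h'.
have hi i : exists y : Zp, (val s)`_i = p%:R * y.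
  have := congr1 (fun q : {poly 'F_p} => q`_i) m0.
  rewrite coef_map coef0 => /(zp_to_Fp_eq0 p_prime) /(zp_divP p_prime).
  by rewrite expn1.
have [y hy] := choice hi.
exists (in_qpoly P (\poly_(i < size (val s)) y i)).
rewrite -[LHS]in_qpoly_val -(rmorph_nat (in_qpoly P)) -rmorphM; congr in_qpoly.
apply/polyP => i; rewrite mulr_natl coefMn coef_poly; case: ltnP => hs.
  by rewrite hy mulr_natl.
by rewrite mul0rn nth_default.
Qed.

Lemma res_red_p : res_red p%:R = 0.
Proof.
rewrite rmorph_nat -(rmorph_nat res_poly p); apply/res_poly_eq0.
suff -> : map_poly (@zp_to_Fp p) p%:R = 0 by rewrite dvdp0.
by rewrite rmorph_nat -polyC_natr pchar_Fp_0.
Qed.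

Lemma qpoly_reg (s : S) : p%:R * s = 0 -> s = 0.
Proof.
rewrite mulr_natl => h; apply: val_inj; apply/polyP => i.
have := congr1 (fun q : S => (val q)`_i) h.
rewrite /= raddfMn /= coefMn coef0 => /esym h'.
by apply: (zp_reg p_prime); rewrite mulr_natl -h'.
Qed.

(* On the Z_p-basis 1, t, t^2, etc. multiplication by [1 + p x] has determinant 1 modulo p. *)
Lemma qpoly_1p_unit (x : S) : exists y, (1 + p%:R * x) * y = 1.
Proof.
pose d := (size P).-1.
have d_gt0 : (0 < d)%N by rewrite /d -ltnS prednK ?size_P_gt1 // ltnW // size_P_gt1.
pose io (a : Zp) : S := in_qpoly P a%:P.
pose T : 'cV[S]_d := \col_i in_qpoly P 'X^i.
pose N : 'M[Zp]_d := \matrix_(i, k) (val (x * T i 0))`_k.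
have decomp (s : S) : s = \sum_(k < d) io (val s)`_k * T k 0.
  rewrite -[LHS]in_qpoly_val -[X in in_qpoly P X]coefK poly_def rmorph_sum /=.
  have hs : (size (val s) <= d)%N.
    by rewrite /d -ltnS prednK ?(ltnW size_P_gt1) // size_qpolyP.
  rewrite (big_ord_widen _ (fun i => in_qpoly P ((val s)`_i *: 'X^i)) hs) big_mkcond.
  apply: eq_bigr => k _; case: ltnP => hk.
    by rewrite -mul_polyC rmorphM mxE.
  by rewrite nth_default // /io polyC0 rmorph0 mul0r.
pose M := 1%:M + p%:R *: N.
have ioB : zmod_morphism io by move=> a c; rewrite /io polyCB rmorphB.
have ioM : monoid_morphism io.
  by split=> [|a c]; rewrite /io ?polyC1 ?in_qpoly1 // polyCM in_qpolyM.
pose ior : {rmorphism Zp -> S} :=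
  HB.pack io (GRing.isZmodMorphism.Build Zp S io ioB) (GRing.isMonoidMorphism.Build Zp S io ioM).
have NT : x *: T = map_mx ior N *m T.
  apply/colP => i; rewrite mxE [RHS]mxE [LHS]decomp.
  by apply: eq_bigr => k _; rewrite !mxE.
have MT : (1 + p%:R * x) *: T = map_mx ior M *m T.
  rewrite /M map_mxD map_mxZ map_mx1 mulmxDl mul1mx -scalemxAl -NT.
  by rewrite scalerDl scale1r scalerA rmorph_nat.
have [u hu] : exists u, \det M * u = 1.
  apply: (zp_unitP p_prime); apply/eqP => d0.
  have : zp_to_Fp (\det M) = 1.
    rewrite -det_map_mx map_mxD map_mxZ map_mx1 rmorph_nat pchar_Fp_0 //.
    by rewrite scale0r addr0 det1.
  by rewrite /zp_to_Fp d0 => /esym/eqP; rewrite oner_eq0.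
(* The vector M^-1 T satisfies (1 + p x) M^-1 T = T, and the entry of [T] at index 0 is t^0 = 1. *)
exists ((map_mx ior (u *: \adj M) *m T) (Ordinal d_gt0) 0).
have : (1 + p%:R * x) *: (map_mx ior (u *: \adj M) *m T) = T.
  rewrite scalemxAr MT mulmxA -map_mxM -scalemxAl mul_adj_mx -mul_scalar_mx -scalar_mxM.
  by rewrite mulrC hu map_mx1 mul1mx.
move/colP/(_ (Ordinal d_gt0)); rewrite !mxE => ->.
by rewrite expr0 in_qpoly1.
Qed.

Lemma res_unit (s : S) : res_red s <> 0 -> exists s', s * s' = 1.
Proof.
move=> /eqP s0.
have [t ht] := res_red_surj (res_red s)^-1.
have [|x hx] := @res_red_eq0 (s * t - 1).
  by rewrite rmorphB rmorphM rmorph1 /= ht mulfV // subrr.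
have [y hy] := qpoly_1p_unit x.
by exists (t * y); rewrite mulrA -(subrK 1 (s * t)) hx addrC hy.
Qed.

Definition unramified_qpoly : unramified P.
Proof.
refine (@Unramified p P S F (in_qpoly P) res_red _ in_qpoly_eq0 res_red_surj res_red_eq0
  res_red_p qpoly_reg res_unit _ _).
- by move=> s; exists (val s); exact: in_qpoly_val.
- by move=> f; rewrite /= res_red_in; exact: res_poly_eq0.
- by rewrite card_qfpoly card_Fp // size_Pb.
Defined.

End Residue.

(** * Lattices in free modules over Z_p[t]/(P) *)

Section HermiteForm.
Variables (p : nat) (P : {poly Zpadic p}) (D : unramified P).
Local Notation S := (ur_ring D).

Lemma ur_regX i (s : S) : p%:R ^+ i * s = 0 -> s = 0.
Proof. by elim: i => [|i IH]; rewrite ?expr0 ?mul1r // exprS -mulrA => /ur_reg /IH. Qed.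

(** A valuation truncated at [i]: powers of p are peeled off until the reduction is nonzero, where
    [ur_unit] gives an inverse. The truncation avoids any appeal to completeness. *)
Lemma ur_val i (s : S) :
  (exists t, s = p%:R ^+ i * t) \/
  exists j, (j < i)%N /\ exists u v, s = p%:R ^+ j * u /\ u * v = 1.
Proof.
elim: i => [|i [[t ->]|[j [ji h]]]]; first by left; exists s; rewrite mul1r.
  have [t0|/eqP t0] := eqVneq (ur_red D t) 0.
    have [t' ->] := ur_red_eq0 t0.
    by left; exists t'; rewrite mulrA exprSr.
  have [v tv] := ur_unit t0.
  by right; exists i; split=> //; exists t, v.
by right; exists j; split; first exact: ltnW.
Qed.

(** The least power of p in [I] generates it: an element of smaller valuation j is p^j times a unit
    and would put p^j in [I]. *)
Lemma ideal_pow (I : S -> Prop) e : (forall a x, I x -> I (a * x)) -> I (p%:R ^+ e) ->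
  exists i, I (p%:R ^+ i) /\ forall x, I x -> exists y, x = p%:R ^+ i * y.
Proof.
move=> IM Ie.
have ex : exists i, `[< I (p%:R ^+ i) >] by exists e; apply/asboolP.
case: (ex_minnP ex) => i /asboolP Ii imin.
exists i; split=> // x Ix.
have [//|[j [ji [u [v [xE uv]]]]]] := ur_val i x.
have /imin : `[< I (p%:R ^+ j) >].
  apply/asboolP; have -> : p%:R ^+ j = v * x by rewrite xE mulrCA [v * u]mulrC uv mulr1.
  exact: IM.
by rewrite leqNgt ji.
Qed.

(** Induction gives a lower triangular basis: the first coordinates of [L] form an ideal generated
    by some p^i, one vector of [L] realises p^i, and clearing the first coordinate with it leaves a
    lattice of rank one less. *)
Lemma hermite e n (L : 'cV[S]_n -> Prop) :
  (forall u v, L u -> L v -> L (u + v)) -> (forall a u, L u -> L (a *: u)) ->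
  (forall u, L (p%:R ^+ e *: u)) ->
  exists A : 'M[S]_n, forall w, L w <-> exists u, w = A *m u.
Proof.
elim: n L => [|n IH] L; last rewrite -[n.+1]/(1 + n)%N in L *; move=> LD LZ Le.
  exists 0 => w; split=> _; first by exists 0; apply/colP; case.
  by rewrite (_ : w = p%:R ^+ e *: w) //; apply/colP; case.
pose I (x : S) := exists w : 'cV[S]_n, L (col_mx x%:M w : 'cV[S]_(1 + n)).
have [||i [[v Lv] Idiv]] := @ideal_pow I e.
- by move=> a x [w Lw]; exists (a *: w); rewrite -scale_scalar_mx -scale_col_mx; exact: LZ.
- exists 0; have := Le (col_mx 1%:M 0 : 'cV[S]_(1 + n)).
  by rewrite scale_col_mx scale_scalar_mx mulr1 scaler0.
have [|||A0 A0P] := IH (fun w => L (col_mx 0 w : 'cV[S]_(1 + n))).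
- by move=> u w Lu Lw; rewrite -[X in col_mx X _]addr0 -add_col_mx; exact: LD.
- by move=> a u Lu; rewrite -[X in col_mx X _](scaler0 _ a) -scale_col_mx; exact: LZ.
- by move=> u; have := Le (col_mx 0 u : 'cV[S]_(1 + n)); rewrite scale_col_mx scaler0.
exists (block_mx (p%:R ^+ i)%:M 0 v A0) => w.
rewrite -[w]vsubmxK [usubmx w]mx11_scalar.
set x := usubmx _ 0 0; set w' := dsubmx _.
split=> [Lw|[u]].
  have [y xE] : exists y, x = p%:R ^+ i * y by apply: Idiv; exists w'.
  have : L (col_mx 0 (w' - y *: v) : 'cV[S]_(1 + n)).
    have -> : col_mx 0 (w' - y *: v) = col_mx x%:M w' + (- y) *: col_mx (p%:R ^+ i)%:M v.
      rewrite scale_col_mx add_col_mx scale_scalar_mx scaleNr xE mulNr mulrC.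
      by rewrite -raddfD /= subrr raddf0.
    by apply: LD => //; exact: LZ.
  move/A0P => [u uE]; exists (col_mx y%:M u).
  rewrite mul_block_col mul0mx addr0 -scalar_mxM -xE mul_mx_scalar -uE.
  by rewrite addrC subrK.
rewrite -[u]vsubmxK [usubmx u]mx11_scalar.
set y := usubmx _ 0 0; set u' := dsubmx _.
rewrite mul_block_col mul0mx addr0 !mul_mx_scalar => ->.
have -> : col_mx (y *: (p%:R ^+ i)%:M) (y *: v + A0 *m u') =
  y *: col_mx (p%:R ^+ i)%:M v + col_mx 0 (A0 *m u').
  by rewrite scale_col_mx add_col_mx addr0.
by apply: LD; [exact: LZ | apply/A0P; exists u'].
Qed.

(** [\det A] kills [w] through the adjugate and divides p^(e n), so regularity of p suffices. *)
Lemma mulmx_pow_reg e n (A B : 'M[S]_n) : A *m B = (p%:R ^+ e)%:M ->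
  forall m (w : 'M[S]_(n, m)), A *m w = 0 -> w = 0.
Proof.
move=> AB m w Aw0.
have dw : \det A *: w = 0 by rewrite -mul_scalar_mx -mul_adj_mx -mulmxA Aw0 mulmx0.
apply/matrixP => i j; rewrite mxE; apply: (@ur_regX (e * n)).
rewrite exprM -det_scalar -AB det_mulmx mulrAC.
have /matrixP/(_ i j) := dw; rewrite !mxE => ->.
by rewrite mul0r.
Qed.

Lemma red_unit_mx n (A : 'M[S]_n) : map_mx (ur_red D) A \in unitmx ->
  exists B, A *m B = 1%:M.
Proof.
rewrite unitmxE unitfE det_map_mx => /eqP /ur_unit [d hd].
by exists (d *: \adj A); rewrite -scalemxAr mul_mx_adj scale_scalar_mx mulrC hd.
Qed.

Lemma red_mx_surj m n (M : 'M[ur_field D]_(m, n)) :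
  exists A : 'M[S]_(m, n), map_mx (ur_red D) A = M.
Proof.
have [f hf] := choice (@ur_red_surj p P D).
by exists (map_mx f M); apply/matrixP => i j; rewrite !mxE hf.
Qed.

Lemma ev_mx_surj m n (M : 'M[S]_(m, n)) : exists A, map_mx (ur_ev D) A = M.
Proof.
have [f hf] := choice (@ur_ev_surj p P D).
by exists (map_mx f M); apply/matrixP => i j; rewrite !mxE hf.
Qed.

End HermiteForm.

(** * Matrices as Z_p[t]-modules and their presentations *)

Section MatrixModule.
Variables (p n : nat).
Local Notation Zp := (Zpadic p).
Local Notation Zt := {poly Zpadic p}.
Implicit Types (X : 'M[Zp]_n.+1) (f : Zt).

Definition mx_subX X : 'M[Zt]_n.+1 := map_mx polyC X - 'X%:M.

(** The projection of Z_p[t]^n onto its quotient by the columns of X - t, identified with Z_p^n on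
    which t acts as [X]. *)
Definition vec_horner X (u : 'cV[Zt]_n.+1) : 'cV[Zp]_n.+1 :=
  \sum_i horner_mx X (u i 0) *m delta_mx i 0.

(** The remainder theorem: f(X) - f(t) is divisible by X - t. The factor X - t stands on the left
    because column modules are compared. *)
Lemma horner_mx_subX X f : exists Q,
  map_mx polyC (horner_mx X f) = f%:M + mx_subX X *m Q.
Proof.
elim/poly_ind: f => [|f c [Q hQ]].
  by exists 0; rewrite mulmx0 addr0 rmorph0 map_mx0 raddf0.
exists (Q *m map_mx polyC X + f%:M).
rewrite rmorphD rmorphM /= horner_mx_X horner_mx_C -[_ * _]/(_ *m _) map_mxD map_mxM hQ.
have key : f%:M *m map_mx polyC X = (f * 'X)%:M + mx_subX X *m f%:M.
  by rewrite -[map_mx polyC X](subrK 'X%:M) -/(mx_subX X) mulmxDr -scalar_mxM addrC scalar_mxC.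
rewrite mulmxDl key mulmxDr raddfD /= map_scalar_mx /= mulmxA -!addrA; congr (_ + _).
by rewrite addrA addrC [X in _ + X]addrC.
Qed.

Lemma vec_hornerD X u v : vec_horner X (u + v) = vec_horner X u + vec_horner X v.
Proof.
by rewrite -big_split; apply: eq_bigr => i _; rewrite mxE rmorphD mulmxDl.
Qed.

Lemma vec_hornerZ X f u : vec_horner X (f *: u) = horner_mx X f *m vec_horner X u.
Proof.
rewrite /vec_horner mulmx_sumr; apply: eq_bigr => i _.
by rewrite mxE rmorphM -mulmxA.
Qed.

Lemma vec_hornerC X v : vec_horner X (map_mx polyC v) = v.
Proof.
rewrite /vec_horner [RHS]matrix_sum_delta; apply: eq_bigr => i _.
by rewrite big_ord1 mxE horner_mx_C mul_scalar_mx.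
Qed.

Lemma vec_horner_sum X (I : finType) (u : I -> 'cV[Zt]_n.+1) :
  vec_horner X (\sum_i u i) = \sum_i vec_horner X (u i).
Proof.
apply: (big_morph (vec_horner X) (@vec_hornerD X)).
rewrite /vec_horner big1 // => i _.
by rewrite mxE rmorph0 mul0mx.
Qed.

Lemma mulmx_sum_cols m k (M : 'M[Zt]_(m, k)) (u : 'cV[Zt]_k) :
  M *m u = \sum_i u i 0 *: col i M.
Proof.
by apply/colP => j; rewrite !mxE summxE; apply: eq_bigr => i _; rewrite !mxE mulrC.
Qed.

Lemma vec_horner_subX X c : vec_horner X (mx_subX X *m c) = 0.
Proof.
rewrite mulmx_sum_cols vec_horner_sum big1 // => i _; rewrite vec_hornerZ.
suff -> : vec_horner X (col i (mx_subX X)) = 0 by rewrite mulmx0.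
have -> : col i (mx_subX X) = map_mx polyC (col i X) + (- 'X) *: map_mx polyC (delta_mx i 0).
  by apply/colP => j; rewrite !mxE eqxx andbT polyC_natr mulNr mulr_natr.
by rewrite vec_hornerD vec_hornerZ !vec_hornerC rmorphN /= horner_mx_X mulNmx -colE subrr.
Qed.

(** Together with [vec_horner_subX] this is exactness: the kernel of [vec_horner X] is the column
    module of X - t. *)
Lemma vec_hornerP X u : exists c, u = map_mx polyC (vec_horner X u) + mx_subX X *m c.
Proof.
have h i : exists c : 'cV[Zt]_n.+1, u i 0 *: delta_mx i 0 =
  map_mx polyC (horner_mx X (u i 0) *m delta_mx i 0) + mx_subX X *m c.
  have [Q hQ] := horner_mx_subX X (u i 0).
  exists (- (Q *m delta_mx i 0)).
  by rewrite map_mxM hQ mulmxDl map_delta_mx mul_scalar_mx mulmxN mulmxA addrK.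
have [c hc] := choice h; exists (\sum_i c i).
rewrite {1}[u]matrix_sum_delta raddf_sum mulmx_sumr -big_split.
by apply: eq_bigr => i _; rewrite big_ord1 hc.
Qed.

End MatrixModule.

(** * Maps to G, their lattices and the presentation criterion *)

Section Quotient.
Variables (p n : nat).
Local Notation Zp := (Zpadic p).
Local Notation Zt := {poly Zpadic p}.
Variables (P : Zt) (D : unramified P) (G : finLmodType Zt) (e : nat).
Local Notation S := (ur_ring D).
Local Notation ev := (ur_ev D).
Local Notation red := (ur_red D).
Hypothesis GP : forall g : G, P *: g = 0.
Hypothesis Ge : forall g : G, (p%:R ^+ e : Zt) *: g = 0.
Implicit Types (X : 'M[Zp]_n.+1) (F : {ffun 'I_n.+1 -> G}).

(** A Z_p-linear map from Z_p^n is stored as the images of the basis vectors, so that it ranges over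
    a finite type; [lcomb] is its extension to Z_p[t]^n and [lcombC] the map itself. *)
Definition lcomb F (u : 'cV[Zt]_n.+1) : G := \sum_i u i 0 *: F i.
Definition lcombC F (v : 'cV[Zp]_n.+1) : G := lcomb F (map_mx polyC v).

Lemma lcombD F u v : lcomb F (u + v) = lcomb F u + lcomb F v.
Proof. by rewrite -big_split; apply: eq_bigr => i _; rewrite mxE scalerDl. Qed.

Lemma lcombZ F a u : lcomb F (a *: u) = a *: lcomb F u.
Proof. by rewrite scaler_sumr; apply: eq_bigr => i _; rewrite mxE scalerA. Qed.

Lemma lcomb0 F : lcomb F 0 = 0.
Proof. by rewrite -(scale0r 0) lcombZ scale0r. Qed.

Lemma lcomb_sum F (I : finType) (u : I -> 'cV[Zt]_n.+1) :
  lcomb F (\sum_i u i) = \sum_i lcomb F (u i).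
Proof. exact: (big_morph (lcomb F) (@lcombD F) (lcomb0 F)). Qed.

Lemma lcomb_delta F i : lcomb F (delta_mx i 0) = F i.
Proof.
rewrite /lcomb (bigD1 i) //= big1 ?addr0 => [|j /negPf ji]; rewrite mxE.
  by rewrite !eqxx scale1r.
by rewrite ji scale0r.
Qed.

Lemma lcomb_colB F m (M N : 'M[Zt]_(n.+1, m)) i :
  lcomb F (col i (M - N)) = lcomb F (col i M) - lcomb F (col i N).
Proof. by rewrite /lcomb -sumrB; apply: eq_bigr => a _; rewrite !mxE scalerBl. Qed.

Lemma lcombCD F u v : lcombC F (u + v) = lcombC F u + lcombC F v.
Proof. by rewrite /lcombC map_mxD lcombD. Qed.

Lemma lcombCZ F a u : lcombC F (a *: u) = a%:P *: lcombC F u.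
Proof. by rewrite /lcombC map_mxZ lcombZ. Qed.

Lemma lcombC_sum F (I : finType) (u : I -> 'cV[Zp]_n.+1) :
  lcombC F (\sum_i u i) = \sum_i lcombC F (u i).
Proof. by rewrite /lcombC raddf_sum lcomb_sum. Qed.

Lemma lcomb_mul0 F k (M : 'M[Zt]_(n.+1, k)) u :
  (forall i, lcomb F (col i M) = 0) -> lcomb F (M *m u) = 0.
Proof.
by move=> h; rewrite mulmx_sum_cols lcomb_sum big1 // => i _; rewrite lcombZ h scaler0.
Qed.

Lemma map_ev_eq0 m k (M : 'M[Zt]_(m, k)) : map_mx ev M = 0 -> exists N, M = P *: N.
Proof.
move=> M0.
have h i j : exists g, M i j = P * g.
  by apply/(ur_ev_eq0 D); have /matrixP/(_ i j) := M0; rewrite !mxE.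
have [f hf] := choice (fun ij : 'I_m * 'I_k => h ij.1 ij.2).
exists (\matrix_(i, j) f (i, j)); by apply/matrixP => i j; rewrite !mxE -(hf (i, j)).
Qed.

(** The first matrix comes from [hermite]. The second records that the lattice contains p^e S^n; it
    makes the first one regular and absorbs changes of X by multiples of p^e. *)
Lemma ex_lattice F : exists LL : 'M[S]_n.+1 * 'M[S]_n.+1,
  (forall u, lcomb F u = 0 <-> exists w, map_mx ev u = LL.1 *m w) /\
  LL.1 *m LL.2 = (p%:R ^+ e)%:M.
Proof.
pose L w := exists u, map_mx ev u = w /\ lcomb F u = 0.
have LE u : L (map_mx ev u) <-> lcomb F u = 0.
  split=> [[v [uv v0]]|]; last by exists u.
  have [|N hN] := @map_ev_eq0 _ _ (u - v); first by rewrite map_mxB uv subrr.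
  by rewrite -(subrK v u) lcombD hN lcombZ GP v0 addr0.
have [|||A hA] := @hermite p P D e _ L.
- move=> _ _ [u [<- u0]] [v [<- v0]]; exists (u + v).
  by rewrite map_mxD lcombD u0 v0 addr0.
- move=> a _ [u [<- u0]]; have [f <-] := ur_ev_surj a.
  by exists (f *: u); rewrite map_mxZ lcombZ u0 scaler0.
- move=> w; have [u <-] := ev_mx_surj w.
  exists (p%:R ^+ e *: u); rewrite lcombZ Ge; split=> //.
  by rewrite map_mxZ rmorphXn /= rmorph_nat.
have h (i : 'I_n.+1) : exists w : 'cV[S]_n.+1, p%:R ^+ e *: delta_mx i 0 = A *m w.
  apply/hA; exists (p%:R ^+ e *: delta_mx i 0); rewrite lcombZ Ge; split=> //.
  by rewrite map_mxZ rmorphXn /= rmorph_nat map_delta_mx.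
have [f hf] := choice h.
exists (A, \matrix_(i, j) f j i 0) => /=; split=> [u|]; first by rewrite -LE hA.
apply/matrixP => i j; have /colP/(_ i) := hf j; rewrite !mxE eqxx andbT.
by rewrite mulr_natr => ->; apply: eq_bigr => k _; rewrite mxE.
Qed.

(* The columns of [lat F] are a basis of the kernel of the map [S^n -> G] induced by [F]. *)
Definition lat F : 'M[S]_n.+1 := (projT1 (cid (ex_lattice F))).1.
Definition colat F : 'M[S]_n.+1 := (projT1 (cid (ex_lattice F))).2.

Lemma latP F u : lcomb F u = 0 <-> exists w, map_mx ev u = lat F *m w.
Proof. by rewrite /lat; case: cid => LL [h _] /=. Qed.

Lemma lat_colat F : lat F *m colat F = (p%:R ^+ e)%:M.
Proof. by rewrite /lat /colat; case: cid => LL [_ h] /=. Qed.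

Lemma lat_reg F m (w : 'M[S]_(n.+1, m)) : lat F *m w = 0 -> w = 0.
Proof. exact: mulmx_pow_reg (lat_colat F) m w. Qed.

Lemma lat_inj F m (w w' : 'M[S]_(n.+1, m)) : lat F *m w = lat F *m w' -> w = w'.
Proof.
by move=> h; apply/eqP; rewrite -subr_eq0; apply/eqP/(@lat_reg F); rewrite mulmxBr h subrr.
Qed.

Definition intertwines X F := forall i, lcomb F (col i (mx_subX X)) = 0.

Lemma lat_cols F m (M : 'M[Zt]_(n.+1, m)) :
  (forall i, lcomb F (col i M) = 0) <-> exists A, map_mx ev M = lat F *m A.
Proof.
split=> [h|[A hA] i]; last first.
  by apply/latP; exists (col i A); rewrite map_col hA !colE mulmxA.
have h' i : exists w, map_mx ev (col i M) = lat F *m w by apply/latP.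
have [f hf] := choice h'.
exists (\matrix_(i, j) f j i 0); apply/matrixP => i j.
have /colP/(_ i) := hf j; rewrite !mxE => ->.
by apply: eq_bigr => k _; rewrite !mxE.
Qed.

Definition spans F := forall g, exists v, lcombC F v = g.

Lemma lcombC_horner X F f v : intertwines X F ->
  lcombC F (horner_mx X f *m v) = f *: lcombC F v.
Proof.
move=> XF; have [Q hQ] := horner_mx_subX X f.
rewrite /lcombC map_mxM hQ mulmxDl lcombD mul_scalar_mx lcombZ -mulmxA.
by rewrite [X in _ + X]lcomb_mul0 ?addr0.
Qed.

Definition presents X F :=
  [/\ forall v, lcombC F (X *m v) = 'X *: lcombC F v, spans F
    & forall v, lcombC F v = 0 <-> exists w, v = horner_mx X P *m w].

Lemma intertwinesP X F :
  (forall v, lcombC F (X *m v) = 'X *: lcombC F v) <-> intertwines X F.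
Proof.
split=> h.
  move=> i; have -> : col i (mx_subX X) = mx_subX X *m map_mx polyC (delta_mx i 0).
    by rewrite map_delta_mx -colE.
  have := h (delta_mx i 0); rewrite /mx_subX mulmxBl -map_mxM mul_scalar_mx -scaleNr.
  by rewrite lcombD lcombZ /lcombC scaleNr => ->; rewrite subrr.
by move=> v; have := lcombC_horner 'X v h; rewrite horner_mx_X.
Qed.

(** Divisibility of X - t by the lattice matrix says that [F] is linear for t acting as [X]. Its
    kernel is then P(X) Z_p^n exactly when the columns of X - t generate the whole lattice over S,
    that is, when [A] is onto, and this is detected modulo p. *)
Lemma presentsP X F : presents X F <->
  spans F /\ exists A, map_mx ev (mx_subX X) = lat F *m A /\ map_mx red A \in unitmx.
Proof.
split=> [[/intertwinesP XF sF kerF]|[sF [A [AE Au]]]].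
  split=> //; have [A AE] := (lat_cols _ _).1 XF; exists A; split=> //.
  (* Lift the lattice vector to Z_p[t]^n and make it constant modulo X - t. It is then killed by
     [F], hence lies in the image of P(X), and P(X) is a multiple of X - t over S because P(t)
     vanishes there. *)
  have surj (w : 'cV[S]_n.+1) : exists c, A *m c = w.
    have [u uE] := ev_mx_surj (lat F *m w).
    have u0 : lcomb F u = 0 by apply/latP; exists w.
    have [c cE] := vec_hornerP X u.
    have /kerF [v vE] : lcombC F (vec_horner X u) = 0.
      by move: u0; rewrite {1}cE lcombD [X in _ + X]lcomb_mul0 ?addr0.
    have [Q QE] := horner_mx_subX X P.
    exists (map_mx ev (Q *m map_mx polyC v + c)).
    have vE' : map_mx polyC (vec_horner X u) =
        P *: map_mx polyC v + mx_subX X *m (Q *m map_mx polyC v).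
      by rewrite vE map_mxM QE mulmxDl mul_scalar_mx mulmxA.
    have evP : ev P = 0 by apply/(ur_ev_eq0 D); exists 1; rewrite mulr1.
    apply: (@lat_inj F); rewrite mulmxA -AE -map_mxM -uE [in RHS]cE vE' mulmxDr.
    by rewrite -addrA [in RHS]map_mxD map_mxZ evP scale0r add0r.
  have [f hf] := choice (fun i : 'I_n.+1 => surj (delta_mx i 0)).
  have AC : A *m (\matrix_(i, j) f j i 0) = 1%:M.
    apply/matrixP => i j; have /colP/(_ i) := hf j; rewrite !mxE eqxx andbT => <-.
    by apply: eq_bigr => k _; rewrite mxE.
  by have := congr1 (map_mx red) AC; rewrite map_mxM map_mx1 => /mulmx1_unit [].
have XF : intertwines X F by apply/lat_cols; exists A.
split=> //; first exact/intertwinesP.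
move=> v; split=> [/latP [w wE]|[w ->]]; last by rewrite lcombC_horner.
(* Inverting [A] writes the constant vector [v] as (X - t) c + P u; applying [vec_horner X] kills
   the first term and turns P into P(X). *)
have [B AB] := red_unit_mx Au.
have [c cE] := ev_mx_surj (B *m w).
have [|u uE] := @map_ev_eq0 _ _ (map_mx polyC v - mx_subX X *m c).
  by rewrite map_mxB map_mxM AE wE cE -!mulmxA [A *m _]mulmxA AB mul1mx subrr.
exists (vec_horner X u).
rewrite -[LHS](vec_hornerC X) -vec_hornerZ -uE vec_hornerD -mulmxN vec_horner_subX addr0.
by [].
Qed.

End Quotient.

(** The part of |G| prime to p is a unit of Z_p, so the p-part of |G| alone annihilates [G]. *)
Lemma finite_p_torsion (p : nat) (p_prime : prime p) (G : finLmodType {poly Zpadic p}) :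
  exists e, forall g : G, (p%:R ^+ e : {poly Zpadic p}) *: g = 0.
Proof.
pose N := #|G|.
have N_gt0 : (0 < N)%N by apply/card_gt0P; exists 0.
have NG (g : G) : g *+ N = 0.
  by rewrite -FinRing.zmodXgE /N -cardsT; apply/eqP; rewrite -order_dvdn order_dvdG ?inE.
have [m pm NE] := pfactor_coprime p_prime N_gt0.
exists (logn p N) => g.
have [|u mu] := @zp_unitP p p_prime m%:R.
  rewrite zpval_natr // zp_modE // modz_nat expn1 eqz_nat -/(dvdn p m).
  by rewrite -prime_coprime.
have -> : (p%:R ^+ logn p N : {poly Zpadic p}) = u%:P * N%:R.
  rewrite [in RHS]NE natrM natrX mulrA -[m%:R]polyC_natr -polyCM [u * _]mulrC mu.
  by rewrite mul1r.
by rewrite -scalerA scaler_nat NG scaler0.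
Qed.

Section Presentations.
Variables (p n : nat).
Local Notation Zp := (Zpadic p).
Local Notation Zt := {poly Zpadic p}.
Variables (P : Zt) (G : finLmodType Zt).
Implicit Types (X : 'M[Zp]_n.+1) (F : {ffun 'I_n.+1 -> G}).

Lemma cok_isoP X : cok_iso X (horner_mx X P) G <-> exists F, presents P X F.
Proof.
split=> [[phi [lin com surj ker]]|[F [com surj ker]]]; last first.
  exists (lcombC F); split=> //.
  by move=> a u v; rewrite lcombCD lcombCZ.
exists [ffun i => phi (delta_mx i 0)].
have phi0 : phi 0 = 0.
  by have := lin 1 0 0; rewrite !scale1r addr0 => /(congr1 (+%R^~ (- phi 0))); rewrite addrK subrr.
have E v : lcombC [ffun i => phi (delta_mx i 0)] v = phi v.
  have phiD u w : phi (u + w) = phi u + phi w by rewrite -{1}[u]scale1r lin scale1r.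
  rewrite [in RHS](matrix_sum_delta v) (big_morph phi phiD phi0).
  apply: eq_bigr => i _; rewrite big_ord1 ffunE mxE.
  by rewrite -[in RHS](addr0 (v i 0 *: _)) lin phi0 addr0.
split=> [v|g|v]; [by rewrite !E com| |rewrite E; exact: ker].
by have [v vg] := surj g; exists v; rewrite E.
Qed.

Lemma lcombC_transfer X F0 F v w : presents P X F0 -> presents P X F ->
  lcombC F0 v = lcombC F0 w <-> lcombC F v = lcombC F w.
Proof.
have h F' : presents P X F' ->
    lcombC F' v = lcombC F' w <-> exists c, v - w = horner_mx X P *m c.
  move=> [_ _ ker]; rewrite -ker -[- w]scaleN1r lcombCD lcombCZ polyCN scaleN1r.
  by split=> [->|/eqP]; rewrite ?subrr // subr_eq0 => /eqP.
by move=> /h -> /h ->.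
Qed.

(** All presentations of [X] have the kernel P(X) Z_p^n, so any two differ by a unique automorphism:
    Aut(G) acts simply transitively on them by composition. *)
Lemma card_presents X : #|[pred F : {ffun 'I_n.+1 -> G} | `[< presents P X F >]]| =
  (card_Aut G * `[< cok_iso X (horner_mx X P) G >])%N.
Proof.
case: (asboolP (cok_iso X (horner_mx X P) G)) => [/cok_isoP [F0 F0P]|nF]; last first.
  rewrite muln0; apply: eq_card0 => F; rewrite inE; apply/negbTE/asboolPn => FP.
  by apply: nF; apply/cok_isoP; exists F.
rewrite muln1 /card_Aut.
pose h (a : {ffun G -> G}) := [ffun i => a (F0 i)] : {ffun 'I_n.+1 -> G}.
have XF0 : intertwines X F0 by apply/intertwinesP; case: F0P.
have hE (a : {ffun G -> G}) v : is_lin_aut a -> a (lcombC F0 v) = lcombC (h a) v.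
  move=> [_ lin].
  have a0 : a 0 = 0.
    by have := lin 1 0 0; rewrite !scale1r addr0 => /(congr1 (+%R^~ (- a 0))); rewrite addrK subrr.
  have aD u w : a (u + w) = a u + a w by rewrite -{1}[u]scale1r lin scale1r.
  rewrite /lcombC /lcomb (big_morph a aD a0); apply: eq_bigr => i _.
  by rewrite ffunE -[in LHS](addr0 (_ *: F0 i)) lin a0 addr0.
have hinj : {in [set f : {ffun G -> G} | `[< is_lin_aut f >]] &, injective h}.
  move=> a b; rewrite !in_setE => /asboolP aP /asboolP bP hab.
  apply/ffunP => g; case: F0P => _ /(_ g) [v <-] _.
  by rewrite !hE // hab.
rewrite -(card_in_image hinj); apply: eq_card => F; rewrite inE.
apply/asboolP/fintype.imageP => [FP|[a]]; last first.
  rewrite in_setE => /asboolP aP ->; case: F0P => com surj ker.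
  have [[b ab ba] lin] := aP.
  have a0 : a 0 = 0.
    by have := lin 1 0 0; rewrite !scale1r addr0 => /(congr1 (+%R^~ (- a 0))); rewrite addrK subrr.
  split=> [v|g|v]; rewrite -?hE //.
  - by rewrite com -[in LHS](addr0 (_ *: _)) lin a0 addr0.
  - by have [v vE] := surj (b g); exists v; rewrite -hE // vE ba.
  - rewrite -ker; split=> [h0|->//].
    by apply: (can_inj ab); rewrite h0 a0.
have [s sP] : {s : G -> 'cV[Zp]_n.+1 | forall g, lcombC F0 (s g) = g}.
  by case: F0P => _ surj _; have [s sP] := choice surj; exists s.
have XF : intertwines X F by apply/intertwinesP; case: FP.
(* The automorphism carrying [F0] to [F], computed through a section [s] of [F0]; equality of the
   kernels makes it independent of [s]. *)
pose a := [ffun g => lcombC F (s g)] : {ffun G -> G}.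
have aE v : a (lcombC F0 v) = lcombC F v.
  by rewrite ffunE; apply/(lcombC_transfer _ _ F0P FP); rewrite sP.
have aP : is_lin_aut a.
  split; last first.
    move=> c u v; rewrite -[u]sP -[v]sP -(lcombC_horner _ _ XF0) -lcombCD !aE.
    by rewrite lcombCD (lcombC_horner _ _ XF).
  apply: injF_bij => u v; rewrite -[u]sP -[v]sP !aE.
  by move/(lcombC_transfer _ _ F0P FP).
exists a; first by rewrite in_setE; apply/asboolP.
apply/ffunP => i; rewrite ffunE.
have dE F' : F' i = lcombC F' (delta_mx i 0) by rewrite /lcombC map_delta_mx lcomb_delta.
by rewrite [in RHS]dE aE -dE.
Qed.

End Presentations.

Section Annihilation.
Variables (p n : nat).
Local Notation Zp := (Zpadic p).
Local Notation Zt := {poly Zpadic p}.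
Variables (P : Zt) (D : unramified P) (G : finLmodType Zt) (e : nat).
Local Notation S := (ur_ring D).
Local Notation ev := (ur_ev D).
Local Notation red := (ur_red D).
Hypothesis GP : forall g : G, P *: g = 0.
Hypothesis Ge : forall g : G, (p%:R ^+ e : Zt) *: g = 0.
Implicit Types (X : 'M[Zp]_n.+1) (F : {ffun 'I_n.+1 -> G}).

(* [X - t = lat F * A] with [B A = 0] modulo [p]; [A] is unique because [lat F] is regular. *)
Definition annihilates X F k (B : 'M[ur_field D]_(k, n.+1)) :=
  exists A, map_mx ev (mx_subX X) = lat D GP Ge F *m A /\ B *m map_mx red A = 0.

(** Since p^e is the lattice matrix times [colat], adding p^(e+1) Z to X changes [A] by a multiple
    of p. The extra factor p is why the precision is e + 1. *)
Lemma lat_factor_periodic X Z F A : map_mx ev (mx_subX X) = lat D GP Ge F *m A ->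
  exists A', map_mx ev (mx_subX (X + p%:R ^+ e.+1 *: Z)) = lat D GP Ge F *m A' /\
    map_mx red A' = map_mx red A.
Proof.
move=> AE; pose C := colat D GP Ge F *m map_mx ev (map_mx polyC Z).
exists (A + p%:R *: C); split; last by rewrite map_mxD map_mxZ ur_red_p scale0r addr0.
rewrite mulmxDr -AE -scalemxAr mulmxA lat_colat mul_scalar_mx scalerA -exprS.
rewrite /mx_subX (map_mxD polyC) addrAC (map_mxD ev (_ - _)); congr (_ + _).
by rewrite !map_mxZ !rmorphXn /= !rmorph_nat.
Qed.

Lemma annihilates_periodic X Z F k (B : 'M[ur_field D]_(k, n.+1)) :
  annihilates (X + p%:R ^+ e.+1 *: Z) F B <-> annihilates X F B.
Proof.
have h Y Z' : annihilates Y F B -> annihilates (Y + p%:R ^+ e.+1 *: Z') F B.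
  by move=> [A [/(lat_factor_periodic Z') [A' [AE' rA]] BA]]; exists A'; rewrite rA.
split; last exact: h.
by move/(h _ (- Z)); rewrite scalerN addrK.
Qed.

Lemma presents_periodic X Z F :
  presents P (X + p%:R ^+ e.+1 *: Z) F <-> presents P X F.
Proof.
have h Y Z' : presents P Y F -> presents P (Y + p%:R ^+ e.+1 *: Z') F.
  move/(presentsP D GP Ge) => [sF [A [/(lat_factor_periodic Z') [A' [AE' rA]] Au]]].
  by apply/(presentsP D GP Ge); split=> //; exists A'; rewrite rA.
split; last exact: h.
by move/(h _ (- Z)); rewrite scalerN addrK.
Qed.

End Annihilation.

(** * Haar measure through residues mod p^N *)

Section Averages.
Variables (R : realType) (p : nat) (p_prime : prime p) (n N : nat).
Local Notation Zp := (Zpadic p).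
Local Notation Mat := 'M[Zpadic p]_n.+1.
Local Notation Q := 'M['I_(p ^ N)]_n.+1.
Implicit Types (X Z : Mat) (Y : Q).

Definition mx_rep Y : Mat := map_mx (fun i : 'I_(p ^ N) => (nat_of_ord i)%:R) Y.

Lemma zp_digit_subproof (x : Zp) : (`|zpval x N|%N < p ^ N)%N.
Proof.
have /andP[x0 xN] := zpval_bound p_prime x N.
by rewrite -ltz_nat gez0_abs // -zp_modE.
Qed.

Definition zp_digit (x : Zp) : 'I_(p ^ N) := Ordinal (zp_digit_subproof x).

Lemma zp_digit_eq x y : zpval x N = zpval y N -> zp_digit x = zp_digit y.
Proof. by move=> h; apply: val_inj => /=; rewrite h. Qed.

Definition mx_res X : Q := map_mx zp_digit X.

Definition avg (f : Mat -> R) : R := (\sum_Y f (mx_rep Y)) / #|{: Q}|%:R.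

Definition periodic (T : Type) (f : Mat -> T) := forall X Z, f (X + p%:R ^+ N *: Z) = f X.

Lemma mx_repK Y : mx_res (mx_rep Y) = Y.
Proof.
apply/matrixP => i j; apply: val_inj; rewrite !mxE /= zpval_natr //.
by rewrite zp_modE // modz_nat absz_nat modn_small.
Qed.

Lemma mx_res_periodic : periodic mx_res.
Proof.
move=> X Z; apply/matrixP => i j; rewrite !mxE; apply: zp_digit_eq.
by rewrite zpvalD -natrX zpval_expM // addr0 zp_red.
Qed.

Lemma mx_resP X : exists Z, X = mx_rep (mx_res X) + p%:R ^+ N *: Z.
Proof.
have [f hf] := choice (fun x : Zp => zp_approx p_prime x N).
by exists (map_mx f X); apply/matrixP => i j; rewrite !mxE -natrX; exact: hf.
Qed.

Lemma mx_resP2 X X' : mx_res X = mx_res X' -> exists Z, X' = X + p%:R ^+ N *: Z.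
Proof.
move=> h; have [Z hZ] := mx_resP X; have [Z' hZ'] := mx_resP X'.
exists (Z' - Z); rewrite -h in hZ'; move: (mx_rep _) hZ hZ' => a -> ->.
by rewrite scalerBr -addrA; congr (a + _); rewrite addrC subrK.
Qed.

Lemma periodic_res (T : Type) (f : Mat -> T) X : periodic f -> f (mx_rep (mx_res X)) = f X.
Proof. by move=> fp; have [Z {2}->] := mx_resP X; rewrite fp. Qed.

Lemma card_res_gt0 : 0 < #|{: Q}|%:R :> R.
Proof. by rewrite ltr0n; apply/card_gt0P; exists (mx_res 0). Qed.

Lemma avgE_sum (I : finType) (P : pred I) (f : I -> Mat -> R) :
  avg (fun X => \sum_(i | P i) f i X) = \sum_(i | P i) avg (f i).
Proof. by rewrite /avg exchange_big /= mulr_suml. Qed.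

Lemma avgZ c f : avg (fun X => c * f X) = c * avg f.
Proof. by rewrite /avg -mulr_sumr mulrA. Qed.

Lemma avg_cst c : avg (fun=> c) = c.
Proof. by rewrite /avg sumr_const -[c *+ _]mulr_natr mulfK // gt_eqF ?card_res_gt0. Qed.

Lemma eq_avg f g : f =1 g -> avg f = avg g.
Proof. by move=> fg; rewrite /avg; congr (_ / _); apply: eq_bigr. Qed.

Lemma avg_shift f Z : periodic f -> avg (fun X => f (X + Z)) = avg f.
Proof.
move=> fp; rewrite /avg; congr (_ / _).
pose h Z Y := mx_res (mx_rep Y + Z).
have hK Z' : cancel (h Z') (h (- Z')).
  move=> Y; rewrite /h; have [Z1] := mx_resP (mx_rep Y + Z').
  move/(congr1 (+%R^~ (- (p%:R ^+ N *: Z1)))); rewrite addrK => <-.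
  by rewrite addrAC addrK -scalerN mx_res_periodic mx_repK.
have hinj : injective (h Z) by apply: can_inj (hK Z).
rewrite [RHS](reindex_inj hinj); apply: eq_bigr => Y _.
by rewrite /h periodic_res.
Qed.

(** Every X lies in exactly one of the |I| translates, and by [avg_shift] all translates have the
    same density. *)
Lemma avg_tile (I : finType) (E : Mat -> bool) (Z : I -> Mat) : periodic E ->
  (forall X, #|[pred i | E (X - Z i)]| = 1%N) -> avg (fun X => (E X)%:R) = #|I|%:R^-1.
Proof.
move=> Ep E1; set a := avg _.
have Ep' : periodic (fun X => (E X)%:R : R) by move=> X Z'; rewrite Ep.
have : #|I|%:R * a = 1.
  rewrite mulr_natl -sumr_const -[RHS](avg_cst 1).
  under eq_bigr => i _ do rewrite /a -(avg_shift (- Z i) Ep').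
  rewrite -avgE_sum; apply: eq_avg => X.
  rewrite -[RHS]/(1%:R) -(E1 X) -sum1_card natr_sum [RHS]big_mkcond.
  by apply: eq_bigr => i _; rewrite inE; case: (E _).
have [->|I0] := eqVneq (#|I|%:R : R) 0; first by rewrite mul0r => /eqP; rewrite eq_sym oner_eq0.
by move=> h; apply: (mulfI I0); rewrite h mulfV.
Qed.

Section Haar.
Variable mu : probability (MatZp p n.+1) R.
Hypothesis mu_haar : is_haar mu.

Definition residue_class Y : set (MatZp p n.+1) := [set X | mx_res X = Y].

Lemma residue_class_measurable Y : measurable (residue_class Y).
Proof.
apply: sub_sigma_algebra; exists N, (mx_trunc N (mx_rep Y)).
apply/seteqP; split=> X /=.
  move=> <-; apply/matrixP => i j; rewrite !mxE zpval_natr //.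
  by rewrite /= gez0_abs ?zpval_ge0 // zp_red.
move=> h; rewrite /residue_class /= -[RHS]mx_repK; apply/matrixP => i j.
by rewrite !mxE; apply: zp_digit_eq; have /matrixP/(_ i j) := h; rewrite !mxE.
Qed.

Lemma residue_class_shift Y Y' :
  [set (mx_rep Y' - mx_rep Y + (X : Mat) : MatZp p n.+1) | X in residue_class Y] = residue_class Y'.
Proof.
apply/seteqP; split=> X /=.
  move=> [X' XY <-]; rewrite /residue_class /=.
  have [|Z ->] := @mx_resP2 (mx_rep Y) X'; first by rewrite mx_repK.
  by rewrite addrA subrK mx_res_periodic mx_repK.
rewrite /residue_class /= => XY.
exists (X - (mx_rep Y' - mx_rep Y)); last by rewrite addrC subrK.
have [|Z ->] := @mx_resP2 (mx_rep Y') X; first by rewrite mx_repK.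
by rewrite opprB addrAC addrCA subrr addr0 mx_res_periodic mx_repK.
Qed.

(** Residue classes modulo p^N are translates of each other, so invariance and total mass 1 give
    them equal measure; a periodic event is a finite disjoint union of them. *)
Lemma haar_periodic (E : Mat -> Prop) : (forall X Z, E (X + p%:R ^+ N *: Z) <-> E X) ->
  mu [set X : MatZp p n.+1 | E X] = (avg (fun X => `[< E X >]%:R))%:E.
Proof.
move=> Ep.
have Ep' : periodic (fun X => `[< E X >]) by move=> X Z; apply: asbool_equiv_eq.
have sumC (s : seq Q) : uniq s ->
    mu [set X : MatZp p n.+1 | mx_res X \in s] = (\sum_(Y <- s) mu (residue_class Y))%E.
  move=> us; rewrite (@fsbig_seq _ _ _ _ s _ us) -measure_fin_bigcup //.
  - by congr (mu _); apply/seteqP; split=> X /=; [exists (mx_res X)|move=> [Y /= Ys ->]].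
  - by move=> Y Y' _ _ [X [/= <- <-]].
  - by move=> Y _; exact: residue_class_measurable.
have muC Y : mu (residue_class Y) = (#|{: Q}|%:R^-1)%:E.
  have eqC Y' : mu (residue_class Y') = mu (residue_class Y).
    by rewrite -(residue_class_shift Y Y') mu_haar //; exact: residue_class_measurable.
  have := sumC (index_enum Q) (index_enum_uniq _).
  have -> : [set X : MatZp p n.+1 | mx_res X \in index_enum Q] = setT.
    by apply/seteqP; split=> // X _ /=; rewrite mem_index_enum.
  rewrite probability_setT; under eq_bigr => Y' _ do rewrite eqC.
  have fin : mu (residue_class Y) \is a fin_num.
    exact: fin_num_measure (residue_class_measurable Y).
  rewrite -(fineK fin) sumEFin sumr_const => -[h]; congr (_%:E).
  apply: (mulfI (lt0r_neq0 card_res_gt0)).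
  by rewrite mulfV ?lt0r_neq0 ?card_res_gt0 // mulr_natl -h.
pose s := [seq Y <- index_enum Q | `[< E (mx_rep Y) >]].
have -> : [set X : MatZp p n.+1 | E X] = [set X : MatZp p n.+1 | mx_res X \in s].
  apply/seteqP; split=> X /=; rewrite mem_filter mem_index_enum andbT (periodic_res _ Ep').
    by move/asboolP.
  by move/asboolP.
rewrite sumC ?filter_uniq ?index_enum_uniq // big_filter.
under eq_bigr => Y _ do rewrite muC.
rewrite sumEFin /avg mulr_suml; congr (_%:E).
by rewrite big_mkcond; apply: eq_bigr => Y _; case: `[< _ >]; rewrite ?mul1r ?mul0r.
Qed.

End Haar.
End Averages.

(** * Counting over a finite field *)

Lemma natr_card (R : pzSemiRingType) (T : finType) (P : pred T) :
  #|P|%:R = \sum_x (P x)%:R :> R.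
Proof.
rewrite -sum1_card natr_sum big_mkcond; apply: eq_bigr => x _.
by rewrite -[x \in P]/(P x); case: (P x).
Qed.

Section FullRankCount.
Variable F : finFieldType.
Local Notation q := #|F|.

Lemma row_free_injP k n (B : 'M[F]_(k, n)) :
  row_free B <-> forall x : 'rV[F]_k, x *m B = 0 -> x = 0.
Proof.
split=> [/row_freeP [C BC] x xB|h].
  by rewrite -[x]mulmx1 -BC mulmxA xB mul0mx.
rewrite -kermx_eq0; apply/eqP/row_matrixP => i; rewrite row0.
by apply: h; rewrite -row_mul mulmx_ker row0.
Qed.

Lemma card_row_space k n (B : 'M[F]_(k, n)) :
  #|[pred b : 'rV[F]_n | (b <= B)%MS]| = (q ^ \rank B)%N.
Proof.
rewrite -(mul1n (\rank B)) -(card_mx F 1 (\rank B)).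
have inj : injective (fun x : 'rV[F]_(\rank B) => x *m row_base B).
  move=> x y /eqP; rewrite -subr_eq0 -mulmxBl => /eqP.
  by move/((row_free_injP _).1 (row_base_free B))/eqP; rewrite subr_eq0 => /eqP.
rewrite -(card_codom inj); apply: eq_card => b; rewrite inE -(eq_row_base B).
by apply/submxP/codomP => -[x ->]; exists x.
Qed.

Lemma row_free_col_mx k n (b : 'rV[F]_n) (B : 'M[F]_(k, n)) :
  row_free (col_mx b B) = row_free B && ~~ (b <= B)%MS.
Proof.
apply/idP/andP => [/row_free_injP h|[/row_free_injP Bf bB]].
  split.
    apply/row_free_injP => x xB; have := h (row_mx 0 x).
    by rewrite mul_row_col mul0mx add0r -row_mx0 => /(_ xB) /eq_row_mx [].
  apply/negP => /submxP [y bE]; have := h (row_mx 1%:M (- y)).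
  rewrite mul_row_col mul1mx mulNmx -bE subrr -row_mx0 => /(_ erefl) /eq_row_mx [].
  by move/matrixP/(_ 0 0)/eqP; rewrite !mxE eqxx oner_eq0.
apply/row_free_injP => x; rewrite -[x]hsubmxK mul_row_col.
rewrite [lsubmx x]mx11_scalar mul_scalar_mx; set a := lsubmx x 0 0; set x' := rsubmx x.
have [->|a0] := eqVneq a 0.
  by rewrite scale0r add0r => /Bf ->; rewrite raddf0 row_mx0.
move/eqP; rewrite addr_eq0 => /eqP abE; case/negP: bB; apply/submxP.
by exists (- a^-1 *: x'); rewrite -scalemxAl scaleNr -scalerN -abE scalerA mulVf // scale1r.
Qed.

(** Add one row at a time: it must lie in the left kernel of [A] and outside the span of the [i]
    rows already chosen, which is contained in that kernel. For k > n - rank A the product has a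
    zero factor. *)
Lemma card_row_free_ker n m k (A : 'M[F]_(n, m)) (R : numFieldType) :
  #|[pred B : 'M[F]_(k, n) | row_free B && (B *m A == 0)]|%:R =
  \prod_(i < k) ((q ^ (n - \rank A))%:R - (q ^ i)%:R) :> R.
Proof.
elim: k => [|k IH].
  rewrite big_ord0 (eq_card (B := predT)) ?cardT_mx //; last first.
    move=> B; rewrite !inE flatmx0 mul0mx eqxx andbT.
    by apply/row_free_injP => x _; apply/rowP; case.
  by rewrite card_mx mul0n expn0.
rewrite big_ord_recr /= -IH.
pose h (xB : 'rV[F]_n * 'M[F]_(k, n)) : 'M[F]_(1 + k, n) := col_mx xB.1 xB.2.
have hbij : bijective h.
  exists (fun M => (usubmx M, dsubmx M)) => [[b B]|M]; last exact: vsubmxK.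
  by rewrite /h /= col_mxKu col_mxKd.
rewrite !natr_card (reindex h) /=; last exact: onW_bij.
rewrite -(pair_bigA _ (fun b B => (row_free (h (b, B)) && (h (b, B) *m A == 0))%:R)) /=.
rewrite exchange_big mulr_suml; apply: eq_bigr => B _.
under eq_bigr => b _ do rewrite /h /= row_free_col_mx mul_col_mx col_mx_eq0.
case: (boolP (row_free B)) => Bf /=; last by rewrite big1 ?mul0r.
case: eqP => BA; last by rewrite big1 ?mul0r // => b _; rewrite !andbF.
rewrite mul1r.
have rB : \rank B = k by apply/eqP.
rewrite -{2}rB -card_row_space -mxrank_ker -card_row_space !natr_card -sumrB.
apply: eq_bigr => b _; rewrite andbT !inE sub_kermx.
case: (boolP (b <= B)%MS) => [/submxP [y ->]|_] /=; last by rewrite subr0.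
by rewrite -mulmxA BA mulmx0 eqxx subrr.
Qed.


Variable R : realFieldType.
Local Notation qR := (q%:R : R).

(** The Moebius value (-1)^k q^(k(k-1)/2) of the subspace lattice divided by |GL_k(F_q)|, the number
    of bases of a k-dimensional space; the powers of q cancel. *)
Definition inv_coef (k : nat) : R := (-1) ^+ k / \prod_(i < k) (qR ^+ i.+1 - 1).

Lemma card_field_gt1 : (1 < q)%N. Proof. exact: card_finNzRing_gt1. Qed.

Lemma qR_gt1 : 1 < qR. Proof. by rewrite ltr1n card_field_gt1. Qed.

Lemma exp_qR_gt1 i : 1 < qR ^+ i.+1.
Proof. by rewrite exprn_egt1 ?qR_gt1. Qed.

Lemma prod_exp_qR_gt0 k : 0 < \prod_(i < k) (qR ^+ i.+1 - 1).
Proof. by apply: prodr_gt0 => i _; rewrite subr_gt0 exp_qR_gt1. Qed.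

(** The q-analogue of summing (-1)^k C(m,k) over k <= K to (-1)^K C(m-1,K), with x = q^m. The right
    side is 1 for m = 0 and 0 for 1 <= m <= K. *)
Lemma inv_coef_telescope (x : R) K :
  \sum_(k < K.+1) inv_coef k * \prod_(i < k) (x - qR ^+ i) =
  inv_coef K * \prod_(i < K) (x - qR ^+ i.+1).
Proof.
elim: K => [|K IH]; first by rewrite big_ord1 !big_ord0.
rewrite big_ord_recr /= IH [X in _ + _ * X]big_ord_recl expr0 [in RHS]big_ord_recr /=.
rewrite mulrCA [in RHS]mulrA.
have -> : inv_coef K = - (inv_coef K.+1 * (qR ^+ K.+1 - 1)).
  rewrite /inv_coef big_ord_recr /= exprS; field.
  by rewrite !lt0r_neq0 ?prod_exp_qR_gt0 // subr_gt0 exp_qR_gt1.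
by ring.
Qed.

(* Moebius inversion on the lattice of subspaces of the cokernel, with subspaces of codimension
   [k] replaced by [k] independent functionals. *)
Lemma unitmx_indicator n (A : 'M[F]_n) :
  (A \in unitmx)%:R = \sum_(k < n.+1) inv_coef k *
     \sum_(B : 'M[F]_(k, n) | row_free B) (B *m A == 0)%:R.
Proof.
set m := (n - \rank A)%N.
transitivity (\sum_(k < n.+1) inv_coef k * \prod_(i < k) ((q ^ m)%:R - qR ^+ i)).
  rewrite inv_coef_telescope -row_free_unit /row_free.
  have := rank_leq_row A; rewrite leq_eqVlt => /orP[/eqP rA|rA].
    rewrite rA eqxx /m rA subnn expn0 /inv_coef.
    under eq_bigr => i _ do rewrite -opprB -mulN1r.
    rewrite big_split /= prodr_const card_ord mulrAC mulfV // mulf_neq0 ?signr_eq0 //.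
    by apply/prodf_neq0 => i _; rewrite subr_eq0 lt_eqF ?exp_qR_gt1.
  (* For singular [A] the factor of index m - 1 is q^m - q^m. *)
  have m_gt0 : (0 < m)%N by rewrite subn_gt0.
  have mn : (m.-1 < n)%N by rewrite prednK // leq_subr.
  by rewrite ltn_eqF //= (bigD1 (Ordinal mn)) //= prednK // -natrX subrr mul0r mulr0.
apply: eq_bigr => k _; congr (_ * _).
rewrite (eq_bigr (fun i : 'I_k => (q ^ m)%:R - (q ^ i)%:R)); last by move=> i _; rewrite !natrX.
rewrite -card_row_free_ker natr_card [RHS]big_mkcond.
by apply: eq_bigr => B _ /=; case: (row_free B).
Qed.

Lemma card_mulmx_eq0 k n m (B : 'M[F]_(k, n)) : row_free B ->
  #|[pred A : 'M[F]_(n, m) | B *m A == 0]|%:R = (q ^ (n * m))%:R / (q ^ (k * m))%:R :> R.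
Proof.
move=> /row_freeP [C BC].
have qn0 i : (q ^ i)%:R != 0 :> R.
  by rewrite natrX expf_neq0 // pnatr_eq0 -lt0n ltnW // card_field_gt1.
apply: (mulIf (qn0 (k * m)%N)); rewrite divfK //.
rewrite -!(card_mx F) -[X in _ * X]sumr_const natr_card mulr_suml.
have shift (Y : 'M[F]_(k, m)) :
    \sum_(A : 'M[F]_(n, m)) (B *m A == 0)%:R = \sum_(A : 'M[F]_(n, m)) (B *m A == Y)%:R :> R.
  rewrite [RHS](reindex_inj (addIr (C *m Y))); apply: eq_bigr => A _.
  by rewrite mulmxDr mulmxA BC mul1mx -{2}(add0r Y) (inj_eq (addIr Y)).
rewrite -mulr_suml mulr_sumr.
under eq_bigr => Y _ do rewrite mulr1 (shift Y).
rewrite exchange_big -[RHS]sumr_const; apply: eq_bigr => A _.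
rewrite (bigD1 (B *m A)) //= eqxx big1 ?addr0 // => Y /negPf; rewrite eq_sym => -> //.
Qed.

(** Both sides are the proportion of invertible matrices: the left averages [unitmx_indicator] over
    all [A], the right counts invertible matrices row by row. *)
Lemma inv_coef_average n :
  \sum_(k < n.+1) inv_coef k *
     (#|[pred B : 'M[F]_(k, n) | row_free B]|%:R / qR ^+ (n * k)) =
  \prod_(1 <= i < n.+1) (1 - qR ^- i).
Proof.
have q0 i : qR ^+ i != 0 by rewrite expf_neq0 // pnatr_eq0 -lt0n ltnW // card_field_gt1.
apply: (mulIf (q0 (n * n)%N)).
transitivity (#|[pred A : 'M[F]_n | A \in unitmx]|%:R : R).
  rewrite [RHS]natr_card; under [RHS]eq_bigr => A _ do rewrite unitmx_indicator.
  rewrite exchange_big mulr_suml; apply: eq_bigr => k _.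
  rewrite -mulr_sumr -mulrA; congr (_ * _); rewrite exchange_big /=.
  rewrite mulrAC -mulrA natr_card mulr_suml [RHS]big_mkcond; apply: eq_bigr => B _ /=.
  case: (boolP (row_free B)) => [Bf|_]; last by rewrite mul0r.
  by rewrite -natr_card card_mulmx_eq0 // mul1r !natrX [(k * n)%N]mulnC.
have -> : #|[pred A : 'M[F]_n | A \in unitmx]| =
    #|[pred B : 'M[F]_(n, n) | row_free B && (B *m (0 : 'M[F]_n) == 0)]|.
  by apply: eq_card => A; rewrite !inE mulmx0 eqxx andbT row_free_unit.
rewrite card_row_free_ker mxrank0 subn0 big_add1 /= big_mkord exprM.
have -> : (qR ^+ n) ^+ n = \prod_(i < n) qR ^+ n by rewrite prodr_const card_ord.
rewrite -big_split [RHS](reindex_inj rev_ord_inj) /=.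
apply: eq_bigr => i _; rewrite subnSK // mulrBl mul1r !natrX; congr (_ - _).
apply: (mulfI (q0 (n - i)%N)); rewrite mulrA mulfV // mul1r -exprD subnK //.
exact: ltnW.
Qed.

(** Each term is a product of factors q/(q^i - 1), of which the first is at most 2 and the later
    ones at most 2/3. So it is at most 3 (2/3)^k, and the geometric series sums to 9 for every q. *)
Lemma inv_coef_bound n : \sum_(k < n) `|inv_coef k| * qR ^+ k <= 9.
Proof.
have q2 : 2 <= qR by rewrite ler_nat card_field_gt1.
have q_gt0 : 0 < qR by apply: lt_trans qR_gt1.
have termE k : `|inv_coef k| * qR ^+ k = \prod_(i < k) (qR / (qR ^+ i.+1 - 1)).
  rewrite /inv_coef normrM normrX normrN1 expr1n mul1r normfV gtr0_norm ?prod_exp_qR_gt0 //.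
  by rewrite big_split prodfV prodr_const card_ord mulrC.
have term k : `|inv_coef k| * qR ^+ k <= 3 * (2 / 3) ^+ k.
  rewrite termE; elim: k => [|[|k] IH]; first by rewrite big_ord0 expr0; lra.
    by rewrite big_ord1 expr1 ler_pdivrMr ?subr_gt0 ?qR_gt1 //; lra.
  rewrite big_ord_recr /= [(2 / 3) ^+ _]exprSr [X in _ <= X]mulrA.
  have den : 0 < qR ^+ k.+2 - 1 by rewrite subr_gt0 exp_qR_gt1.
  apply: ler_pM => //; first apply: prodr_ge0 => i _.
    by rewrite divr_ge0 ?subr_ge0 // ltW // exp_qR_gt1.
    by rewrite divr_ge0 // ltW.
  rewrite ler_pdivrMr // !exprS; have : 1 <= qR ^+ k by rewrite exprn_ege1 // ltW // qR_gt1.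
  by move: (qR ^+ k) => y y1; nra.
apply: (@le_trans _ _ (\sum_(k < n) 3 * (2 / 3) ^+ k)); first by apply: ler_sum.
suff -> : \sum_(k < n) 3 * (2 / 3) ^+ k = 9 - 9 * (2 / 3) ^+ n :> R.
  by rewrite gerBl mulr_ge0 // exprn_ge0 // divr_ge0.
elim: n => [|n IH]; first by rewrite big_ord0 expr0 mulr1 subrr.
by rewrite big_ord_recr /= IH exprS; move: (_ ^+ n) => x; lra.
Qed.

End FullRankCount.

(** * Joint annihilation of several residue matrices *)

Section Joint.
Variables (R : realType) (p : nat) (p_prime : prime p) (n l : nat).
Local Notation Zp := (Zpadic p).
Local Notation Zt := {poly Zpadic p}.
Variables (P : 'I_l -> Zt) (D : forall j, unramified (P j)).
Variables (G : 'I_l -> finLmodType Zt) (e : nat).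
Hypothesis GP : forall j (g : G j), P j *: g = 0.
Hypothesis Ge : forall j (g : G j), (p%:R ^+ e : Zt) *: g = 0.
Variable E : 'I_l -> Zt.
Hypothesis evE : forall i j, ur_ev (D i) (E j) = (i == j)%:R.
Local Notation FF j := (ur_field (D j)).
Variables (F : forall j, {ffun 'I_n.+1 -> G j}) (k : 'I_l -> nat).
Variable B : forall j, 'M[FF j]_(k j, n.+1).
Local Notation LT j := (lat (D j) (@GP j) (@Ge j) (F j)).
Implicit Types (X : 'M[Zp]_n.+1) (v : 'cV[Zp]_n.+1).

Definition all_annihilate X :=
  forall j, annihilates (D := D j) (@GP j) (@Ge j) X (F j) (B j).

Definition jointly_spans := forall g : (forall j, G j), exists v, forall j, lcombC (F j) v = g j.

(** A relation because the underlying map, v = Lam W to B W modulo p, is defined only on the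
    lattice; there W is unique. *)
Definition lat_coord m (M : 'M[Zp]_(n.+1, m)) j (Y : 'M[FF j]_(k j, m)) :=
  exists W, map_mx (ur_ev (D j)) (map_mx polyC M) = LT j *m W /\
    B j *m map_mx (ur_red (D j)) W = Y.

Definition jointly_covers := forall y : (forall j, 'cV[FF j]_(k j)),
  exists v, forall j, @lat_coord 1 v j (y j).

Lemma E_scale i j (g : G i) : E j *: g = if i == j then g else 0.
Proof.
case: eqP => [<-|/eqP ij].
  have /(ur_ev_eq0 (D i)) [h hE] : ur_ev (D i) (E i - 1) = 0.
    by rewrite rmorphB rmorph1 /= evE eqxx subrr.
  by rewrite -(subrK 1 (E i)) hE scalerDl scale1r mulrC -scalerA GP scaler0 add0r.
have /(ur_ev_eq0 (D i)) [h ->] : ur_ev (D i) (E j) = 0 by rewrite evE (negPf ij).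
by rewrite mulrC -scalerA GP scaler0.
Qed.

Lemma annihilate_intertwines X j : all_annihilate X -> intertwines X (F j).
Proof. by move=> /(_ j) [A [AE _]]; apply/(lat_cols (D j) (@GP j) (@Ge j)); exists A. Qed.

(** [X] intertwines every F_i, so E_j(X) acts on G_i as the identity or as 0, and preimages found
    separately for each j can be added. *)
Lemma annihilate_spans X : all_annihilate X -> (forall j, spans (F j)) -> jointly_spans.
Proof.
move=> ann sF g; have [v vE] := choice (fun j => (sF j (g j))).
exists (\sum_j horner_mx X (E j) *m v j) => i.
have Xi := annihilate_intertwines i ann.
rewrite lcombC_sum (bigD1 i) //= big1 => [|j /negPf ji].
  by rewrite addr0 lcombC_horner // E_scale eqxx.
by rewrite lcombC_horner // E_scale eq_sym ji.
Qed.

(* In [S_i], [v] and [vec_horner X v] differ by a multiple of [X - t = lat (F i) * A], which [B i]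
   kills modulo p; the idempotents [E] glue the different [i]. *)
Lemma annihilate_covers X : all_annihilate X -> (forall j, row_free (B j)) -> jointly_covers.
Proof.
move=> ann Bf y.
have h j : exists xu : 'cV[Zt]_n.+1 * 'cV[ur_ring (D j)]_n.+1,
    map_mx (ur_ev (D j)) xu.1 = LT j *m xu.2 /\ B j *m map_mx (ur_red (D j)) xu.2 = y j.
  have /row_freeP [C BC] := Bf j.
  have [u uE] := red_mx_surj (C *m y j).
  have [x xE] := ev_mx_surj (LT j *m u).
  by exists (x, u); rewrite xE uE mulmxA BC mul1mx.
pose xu j := projT1 (cid (h j)); have xuE j := projT2 (cid (h j)).
rewrite -/(xu _) in xuE.
pose U := \sum_j E j *: (xu j).1.
have [c cE] := vec_hornerP X U.
exists (vec_horner X U) => i.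
have [A [AE BA]] := ann i; have [xE uE] := xuE i.
have evU : map_mx (ur_ev (D i)) U = LT i *m (xu i).2.
  rewrite -xE /U raddf_sum (bigD1 i) //= big1 => [|j /negPf ji].
    by rewrite addr0 map_mxZ evE eqxx scale1r.
  by rewrite map_mxZ evE eq_sym ji scale0r.
exists ((xu i).2 - A *m map_mx (ur_ev (D i)) c); split.
  rewrite mulmxBr mulmxA -AE -evU {2}cE map_mxD map_mxM addrK //.
by rewrite map_mxB map_mxM mulmxBr mulmxA BA mul0mx subr0.
Qed.

Lemma lat_coord_cols (M : 'M[Zp]_n.+1) j (Y : 'M[FF j]_(k j, n.+1)) :
  (forall i, @lat_coord 1 (col i M) j (col i Y)) -> @lat_coord n.+1 M j Y.
Proof.
move=> /choice [w wE]; exists (\matrix_(a, i) w i a 0); split.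
  apply/matrixP => a i; have [/colP/(_ a)] := wE i; rewrite !mxE => -> _.
  by apply: eq_bigr => b _; rewrite !mxE.
apply/matrixP => a i; have [_ /colP/(_ a)] := wE i; rewrite !mxE => <-.
by apply: eq_bigr => b _; rewrite !mxE.
Qed.

Lemma mx_subXB X Z : mx_subX (X - Z) = mx_subX X - map_mx polyC Z.
Proof. by rewrite /mx_subX map_mxB addrAC. Qed.

(** The event fixes the images of X - t in the G_j and then the residues B_j A_j. Joint surjectivity
    supplies translations that realise every value of both, so the translates of the event tile the
    space. *)
Lemma annihilate_avg : jointly_spans -> jointly_covers ->
  avg e.+1 (fun X => `[< all_annihilate X >]%:R) =
  \prod_j ((#|G j|%:R ^+ n.+1)^-1 * (#|FF j|%:R ^+ (n.+1 * k j))^-1) :> R.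
Proof.
move=> sF sB.
pose I1 := fprod (fun j => {ffun 'I_n.+1 -> G j}).
pose I2 := fprod (fun j => 'M[FF j]_(k j, n.+1)).
have hg (g : I1) : exists Z, forall j i, lcombC (F j) (col i Z) = g j i.
  have [f fE] := choice (fun i => sF (fun j => g j i)).
  exists (\matrix_(a, i) f i a 0) => j i; rewrite -fE; congr lcombC.
  by apply/colP => a; rewrite !mxE.
have hv (v : I2) : exists Z, forall j, @lat_coord n.+1 Z j (v j).
  have [f fE] := choice (fun i => sB (fun j => col i (v j))).
  exists (\matrix_(a, i) f i a 0) => j; apply: lat_coord_cols => i.
  rewrite (_ : col i _ = f i); first exact: fE.
  by apply/colP => a; rewrite !mxE.
have [Zg ZgE] := choice hg; have [Zv ZvE] := choice hv.
rewrite (@avg_tile R p p_prime n e.+1 (I1 * I2)%type _ (fun gv => Zg gv.1 + Zv gv.2)).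
- rewrite card_prod natrM !card_fprod !natr_prod invfM -!prodfV -big_split /=.
  apply: eq_bigr => j _; rewrite card_ffun card_ord natrX card_mx natrX.
  by rewrite [(k j * _)%N]mulnC.
- move=> X Z; apply: asbool_equiv_eq; split=> h j.
    by have := h j; rewrite annihilates_periodic.
  by rewrite annihilates_periodic.
move=> X.
(* [g0] is the only choice that moves X - t into all the lattices, and [v0] is then the only one
   that cancels the residues B_j A_j. *)
pose g0 : I1 := [fprod j => [ffun i => lcomb (F j) (col i (mx_subX X))]].
have gE (g : I1) (v : I2) j i :
    lcomb (F j) (col i (mx_subX (X - (Zg g + Zv v)))) = g0 j i - g j i.
  have v0 : lcomb (F j) (col i (map_mx polyC (Zv v))) = 0.
    have [W [WE _]] := ZvE v j.
    by move: i; apply/(lat_cols (D j) (@GP j) (@Ge j)); exists W.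
  by rewrite fprodE ffunE -ZgE /lcombC map_col opprD addrA !mx_subXB !lcomb_colB v0 subr0.
have h j : exists A, map_mx (ur_ev (D j)) (mx_subX (X - Zg g0)) = LT j *m A.
  apply/(lat_cols (D j) (@GP j) (@Ge j)) => i.
  by rewrite mx_subXB lcomb_colB -map_col -/(lcombC _ _) ZgE fprodE ffunE subrr.
pose A j := projT1 (cid (h j)); have AE j : _ = LT j *m A j := projT2 (cid (h j)).
pose v0 : I2 := [fprod j => B j *m map_mx (ur_red (D j)) (A j)].
rewrite (eq_card (B := pred1 (g0, v0))) ?card1 // => -[g v]; rewrite !inE /=.
apply/asboolP/eqP => [ann|[-> ->] j]; last first.
  have [W [WE BW]] := ZvE v0 j.
  exists (A j - W); split; first by rewrite opprD addrA mx_subXB map_mxB AE WE mulmxBr.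
  by rewrite map_mxB mulmxBr BW fprodE subrr.
have gg0 : g = g0.
  apply/fprodP => j; apply/ffunP => i.
  have := annihilate_intertwines j ann i; rewrite gE => /eqP.
  by rewrite subr_eq0 => /eqP.
congr (_, _) => //; apply/fprodP => j; rewrite fprodE.
have [C [CE BC]] := ann j; have [W [WE <-]] := ZvE v j.
have -> : W = A j - (A j - W) by rewrite opprB addrC subrK.
have -> : A j - W = C.
  apply: (@lat_inj _ _ _ (D j) (G j) e (@GP j) (@Ge j) (F j)).
  by rewrite -CE gg0 opprD addrA mx_subXB map_mxB AE WE mulmxBr.
by rewrite map_mxB mulmxBr BC subr0.
Qed.

End Joint.

(** * Tests that fail to be onto are rare *)

Definition misses_value (I T : finType) (f : {ffun I -> T}) := [exists t, [forall i, f i != t]].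

(** Union bound over the missed value. *)
Lemma card_misses_value (I T : finType) :
  (#|[pred f : {ffun I -> T} | misses_value f]| <= #|T| * (#|T| - 1) ^ #|I|)%N.
Proof.
apply: (@leq_trans (\sum_t #|[pred f : {ffun I -> T} | [forall i, f i != t]]|)).
  rewrite -sum1_card.
  under [X in (_ <= X)%N]eq_bigr => t _ do rewrite -sum1_card big_mkcond.
  rewrite exchange_big [X in (X <= _)%N]big_mkcond; apply: leq_sum => f _ /=.
  case: ifP => // /existsP [t ft]; rewrite (bigD1 t) //= inE ft.
  by rewrite leq_addr.
rewrite (eq_bigr (fun=> (#|T| - 1) ^ #|I|)%N) ?sum_nat_const // => t _.
rewrite subn1 -(cardC1 t) -card_ffun_on; apply: eq_card => f.
by rewrite [LHS]inE; apply/forallP/ffun_onP => h i; have := h i; rewrite inE.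
Qed.

Lemma card_misses_value_inj (I T Y : finType) (h : Y -> {ffun I -> T}) : injective h ->
  (#|[pred y | misses_value (h y)]| <= #|T| * (#|T| - 1) ^ #|I|)%N.
Proof.
move=> hinj; apply: leq_trans (card_misses_value I T).
rewrite -(fintype.card_image hinj); apply: subset_leq_card; apply/fintype.subsetP => f.
by move=> /fintype.imageP [y yP ->].
Qed.

Section KernelVectors.
Variables (p n l : nat).
Local Notation Zp := (Zpadic p).
Variables (G : 'I_l -> finLmodType {poly Zpadic p}) (F : forall j, {ffun 'I_n.+1 -> G j}).

(* Two subsets of a block of [s] coordinates have the same sum under [F], by pigeonhole; the
   difference of their indicator vectors has entries in {-1, 0, 1}. *)
Lemma ex_kernel_vectors m s : (\prod_j #|G j| < 2 ^ s)%N -> (m * s <= n.+1)%N ->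
  exists (V : 'M[Zp]_(n.+1, m)) (C : 'M[Zp]_(m, n.+1)),
    C *m V = 1%:M /\ forall j i, lcombC (F j) (col i V) = 0.
Proof.
move=> Gs ms.
have pos_lt (b : 'I_m) (i : 'I_s) : (b * s + i < n.+1)%N.
  apply: leq_trans ms; apply: (@leq_trans (b.+1 * s)%N); last by rewrite leq_mul2r ltn_ord orbT.
  by rewrite mulSn addnC ltn_add2r.
pose pos b i := Ordinal (pos_lt b i).
have pos_inj b i b' i' : pos b i = pos b' i' -> (b, i) = (b', i').
  move/(congr1 val) => /= h.
  have s0 : (0 < s)%N by apply: leq_trans (ltn_ord i).
  have := congr1 (fun x => x %/ s)%N h; have := congr1 (fun x => x %% s)%N h.
  rewrite !modnMDl !modn_small ?divnMDl ?divn_small // !addn0 => ii bb.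
  by congr (_, _); apply: val_inj.
pose ind (f : {ffun 'I_s -> bool}) b : 'cV[Zp]_n.+1 := \sum_i (f i)%:R *: delta_mx (pos b i) 0.
have indE f b b' i : ind f b (pos b' i) 0 = ((b == b') && f i)%:R.
  rewrite summxE (eq_bigr (fun i' => ((pos b' i == pos b i') && f i')%:R)); last first.
    by move=> i' _; rewrite !mxE eqxx andbT -natrM mulnb andbC.
  case: eqP => [<-|bb]; last first.
    by rewrite big1 // => i' _; case: eqP => // /pos_inj [/esym].
  rewrite (bigD1 i) //= eqxx big1 ?addr0 // => i' /eqP ii'.
  by case: eqP => // /pos_inj [/esym].
have hb b : exists ff : {ffun 'I_s -> bool} * {ffun 'I_s -> bool}, exists i,
    ff.1 i != ff.2 i /\ forall j, lcombC (F j) (ind ff.1 b) = lcombC (F j) (ind ff.2 b).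
  pose h (f : {ffun 'I_s -> bool}) : fprod G := [fprod j => lcombC (F j) (ind f b)].
  have /injectivePn [f [f' ff' hE]] : ~~ injectiveb h.
    apply/negP => /injectiveP /leq_card; rewrite card_fprod card_ffun card_bool card_ord.
    by rewrite leqNgt Gs.
  exists (f, f').
  have /existsP [i fi] : [exists i, f i != f' i].
    apply: contraNT ff'; rewrite negb_exists => /forallP e; apply/eqP/ffunP => i.
    by have := e i; rewrite negbK => /eqP.
  by exists i; split=> // j; have := congr1 (fun t : fprod G => t j) hE; rewrite !fprodE.
have [ff /choice [c ffP]] := choice hb.
pose sg b : Zp := ((ff b).1 (c b))%:R - ((ff b).2 (c b))%:R.
have sg2 b : sg b * sg b = 1.
  have [ne _] := ffP b; move: ne; rewrite /sg.
  by case: ((ff b).1 (c b)); case: ((ff b).2 (c b)) => // _;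
    rewrite ?sub0r ?subr0 ?mulrNN mulr1.
(* In each block, [C] reads a coordinate where the two indicators differ. The entry there is 1 or
   -1, so it is its own inverse, and disjointness of the blocks gives C V = 1. *)
exists (\matrix_(a, b) (ind (ff b).1 b - ind (ff b).2 b) a 0),
  (\matrix_(b, a) (sg b * (a == pos b (c b))%:R)); split.
  apply/matrixP => b b'; rewrite !mxE (bigD1 (pos b (c b))) //= big1 ?addr0 => [|a /negPf ab].
    rewrite !mxE eqxx mulr1 !indE eq_sym.
    by case: eqP => [->|] /=; rewrite ?subr0 ?mulr0 // sg2.
  by rewrite !mxE ab mulr0 mul0r.
move=> j b; have [_ h] := ffP b.
rewrite (_ : col b _ = ind (ff b).1 b + (-1) *: ind (ff b).2 b); last first.
  by apply/colP => a; rewrite !mxE mulN1r.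
by rewrite lcombCD lcombCZ h polyCN scaleN1r subrr.
Qed.

End KernelVectors.

Section BadTests.
Variables (p n l : nat).
Local Notation Zp := (Zpadic p).
Local Notation Zt := {poly Zpadic p}.
Variables (P : 'I_l -> Zt) (D : forall j, unramified (P j)).
Variables (G : 'I_l -> finLmodType Zt) (e : nat).
Hypothesis GP : forall j (g : G j), P j *: g = 0.
Hypothesis Ge : forall j (g : G j), (p%:R ^+ e : Zt) *: g = 0.
Local Notation FF j := (ur_field (D j)).

(** If the images of the basis vectors alone exhaust the product of the G_j, then [F] spans jointly;
    otherwise these n + 1 values miss a tuple. *)
Lemma card_not_spanning :
  (#|[pred F : fprod (fun j => {ffun 'I_n.+1 -> G j}) | `[< ~ jointly_spans F >]]|
    <= \prod_j #|G j| * (\prod_j #|G j| - 1) ^ n.+1)%N.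
Proof.
pose h (F : fprod (fun j => {ffun 'I_n.+1 -> G j})) : {ffun 'I_n.+1 -> fprod G} :=
  [ffun i => [fprod j => F j i]].
have hinj : injective h.
  move=> F F' /ffunP hF; apply/fprodP => j; apply/ffunP => i.
  by have := congr1 (fun t : fprod G => t j) (hF i); rewrite !ffunE !fprodE.
have := card_misses_value_inj hinj; rewrite card_fprod card_ord; apply: leq_trans.
apply: subset_leq_card; apply/fintype.subsetP => F; rewrite !inE => /asboolP; apply: contra_notT.
rewrite negb_exists => /forallP hF g.
have := hF [fprod j => g j]; rewrite negb_forall => /existsP [i]; rewrite negbK => /eqP iE.
exists (delta_mx i 0) => j; rewrite /lcombC map_delta_mx lcomb_delta.
by have := congr1 (fun t : fprod G => t j) iE; rewrite ffunE !fprodE.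
Qed.

Variables (F : forall j, {ffun 'I_n.+1 -> G j}) (k : 'I_l -> nat) (m s : nat).
Hypothesis Gs : (\prod_j #|G j| < 2 ^ s)%N.
Hypothesis ms : (m * s <= n.+1)%N.
Local Notation W := (\prod_j #|FF j| ^ k j)%N.
Local Notation Tests := (fprod (fun j => 'M[FF j]_(k j, n.+1))).

(** The columns of [V] give m sample vectors of ker F, on which the test B takes the values B xi. As
    [psi] is a left inverse of [xi], adding y psi to B shifts these values by y: they are uniform,
    and the union bound applies to m independent samples among W values. *)
Lemma card_not_covering :
  (#|[pred B : Tests | `[< ~ jointly_covers (D := D) GP Ge F B >]]| * W ^ m <=
    #|{: Tests}| * (W * (W - 1) ^ m))%N.
Proof.
have [V [C [CV V0]]] := ex_kernel_vectors F Gs ms.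
have hV j : exists A, map_mx (ur_ev (D j)) (map_mx polyC V) = lat (D j) (@GP j) (@Ge j) (F j) *m A.
  by apply/(lat_cols (D j) (@GP j) (@Ge j)) => i; rewrite -map_col; exact: V0.
pose A j := projT1 (cid (hV j)); have AE j := projT2 (cid (hV j)); rewrite -/(A _) in AE.
pose xi j := map_mx (ur_red (D j)) (A j).
pose psi j := map_mx (ur_red (D j)) (map_mx (ur_ev (D j)) (map_mx polyC C) *m
  lat (D j) (@GP j) (@Ge j) (F j)).
have psixi j : psi j *m xi j = 1%:M.
  by rewrite -map_mxM -mulmxA -AE -!map_mxM CV !map_mx1.
pose Y := fprod (fun j => 'M[FF j]_(k j, m)).
pose T := fprod (fun j => 'cV[FF j]_(k j)).
have cardT : #|T| = W.
  by rewrite card_fprod; apply: eq_bigr => j _; rewrite card_mx muln1.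
have cardY : #|{: Y}| = (W ^ m)%N.
  rewrite card_fprod (big_morph (expn^~ m) (fun x y => expnMn x y m) (exp1n m)).
  by apply: eq_bigr => j _; rewrite card_mx expnM.
pose cols (y : Y) : {ffun 'I_m -> T} := [ffun i => [fprod j => col i (y j)]].
have colsinj : injective cols.
  move=> y y' /ffunP hy; apply/fprodP => j; apply/matrixP => a i.
  have := congr1 (fun t : T => t j a 0) (hy i); rewrite !ffunE !fprodE !mxE //.
pose im (B : Tests) : Y := [fprod j => B j *m xi j].
have bad (B : Tests) : ~ jointly_covers (D := D) GP Ge F B -> misses_value (cols (im B)).
  apply: contra_notT; rewrite negb_exists => /forallP hB y.
  have := hB [fprod j => y j]; rewrite negb_forall => /existsP [i]; rewrite negbK => /eqP iE.
  exists (col i V) => j; exists (col i (A j)); rewrite !map_col AE !colE !mulmxA; split=> //.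
  by have := congr1 (fun t : T => t j) iE; rewrite ffunE !fprodE colE.
pose addY (y y' : Y) : Y := [fprod j => y j + y' j].
pose shift (y : Y) (B : Tests) : Tests := [fprod j => B j + y j *m psi j].
have shift_inj y : injective (shift y).
  move=> B B' h; apply/fprodP => j.
  by have := congr1 (fun t : Tests => t j) h; rewrite !fprodE => /addIr.
have im_shift y B : im (shift y B) = addY (im B) y.
  by apply/fprodP => j; rewrite !fprodE mulmxDl -mulmxA psixi mulmx1.
rewrite -cardY -cardT.
apply: (@leq_trans (#|[pred B | misses_value (cols (im B))]| * #|{: Y}|)%N).
  rewrite leq_mul2r; apply/orP; right; apply: subset_leq_card; apply/fintype.subsetP => B.
  by rewrite !inE => /asboolP /bad.
rewrite mulnC -sum_nat_const -[X in (_ <= X)%N]sum_nat_const.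
(* Each shift permutes the tests. After exchanging the sums, the samples of a fixed B run once
   through all of [Y]. *)
have -> : (\sum_(y : Y) #|[pred B | misses_value (cols (im B))]| =
    \sum_(y : Y) \sum_(B : Tests) misses_value (cols (addY (im B) y)))%N.
  apply: eq_bigr => y _; rewrite -sum1_card big_mkcond (reindex_inj (shift_inj y)) /=.
  by apply: eq_bigr => B _; rewrite inE im_shift; case: misses_value.
rewrite exchange_big; apply: leq_sum => B _ /=.
have inj2 : injective (fun y => cols (addY (im B) y)).
  move=> y y' /colsinj h; apply/fprodP => j.
  by have := congr1 (fun t : Y => t j) h; rewrite !fprodE => /addrI.
have := card_misses_value_inj inj2; rewrite card_ord; apply: leq_trans.
rewrite -sum1_card [X in (_ <= X)%N]big_mkcond; apply: leq_sum => y _.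
by rewrite inE; case: misses_value.
Qed.

End BadTests.

Lemma prod_sum_fprod (R : comNzRingType) (I : finType) (T : I -> finType) (f : forall i, T i -> R) :
  \prod_i \sum_x f i x = \sum_(t : fprod T) \prod_i f i (t i).
Proof.
pose P i : {ffun T i -> R} := [ffun x => f i x].
transitivity (\sum_(t : fprod T) \prod_(i in I) P i (t i)); last first.
  by apply: eq_bigr => t _; apply: eq_bigr => i _; rewrite ffunE.
rewrite (@big_fprod R 0 1 *%R +%R I T P).
rewrite -(@bigA_distr_big_dep R 0 1 *%R +%R I {i : I & T i} (fun i => tagged_with T i)
  (fun i u => untag 0 (P i) u)).
apply: eq_bigr => i _; rewrite -(big_tag P).
by apply: eq_bigr => x _; rewrite ffunE.
Qed.

Lemma asbool_forall_prod (R : comNzRingType) (I : finType) (Q : I -> Prop) :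
  (`[< forall i, Q i >]%:R : R) = \prod_i `[< Q i >]%:R.
Proof.
case: asboolP => [h|h]; first by rewrite big1 // => i _; case: asboolP.
have /existsP [i Qi] : [exists i, ~~ `[< Q i >]].
  apply: contra_notT h; rewrite negb_exists => /forallP h i.
  by have := h i; rewrite negbK => /asboolP.
by rewrite (bigD1 i) //= (negPf Qi) mul0r.
Qed.

(** The union bound is useless when W is large against m. It is kept for W <= M, where it increases
    with W; beyond the cutoff M the trivial bound x <= 1 is weakened to W/M. *)
Lemma missed_fraction_bound (R : realFieldType) (M W m : nat) (x : R) : (0 < M)%N -> (0 < W)%N ->
  x <= 1 -> x * W%:R ^+ m <= W%:R * (W - 1)%:R ^+ m ->
  x <= M%:R * (1 - M%:R^-1) ^+ m + W%:R / M%:R.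
Proof.
move=> M0 W0 x1 xW.
have Mp : 0 < M%:R :> R by rewrite ltr0n.
have Wp : 0 < W%:R :> R by rewrite ltr0n.
have M1 : 0 <= 1 - M%:R^-1 :> R by rewrite subr_ge0 invf_le1 // ler1n.
have W1 : 0 <= 1 - W%:R^-1 :> R by rewrite subr_ge0 invf_le1 // ler1n.
have [WM|MW] := leqP W M; last first.
  apply: (le_trans x1); apply: (@le_trans _ _ (W%:R / M%:R)).
    by rewrite ler_pdivlMr // mul1r ler_nat ltnW.
  by rewrite lerDr mulr_ge0 ?exprn_ge0 // ltW.
apply: (@le_trans _ _ (W%:R * (1 - W%:R^-1) ^+ m)).
  rewrite -(@ler_pM2r _ (W%:R ^+ m)) ?exprn_gt0 // -mulrA -exprMn mulrBl mul1r mulVf ?lt0r_neq0 //.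
  by rewrite natrB in xW.
apply: (@le_trans _ _ (M%:R * (1 - M%:R^-1) ^+ m)); last first.
  by rewrite lerDl divr_ge0 // ltW.
apply: ler_pM => //; rewrite ?exprn_ge0 ?ler_nat ?(ltW Wp) //.
by rewrite lerXn2r ?nnegrE // lerD2l lerN2 lef_pV2 ?posrE // ler_nat.
Qed.

(** * The weighted count: exact main term and error *)

Section Core.
Variables (R : realType) (p : nat) (p_prime : prime p) (n l : nat).
Local Notation Zp := (Zpadic p).
Local Notation Zt := {poly Zpadic p}.
Variables (P : 'I_l -> Zt) (D : forall j, unramified (P j)).
Variables (G : 'I_l -> finLmodType Zt) (e : nat).
Hypothesis GP : forall j (g : G j), P j *: g = 0.
Hypothesis Ge : forall j (g : G j), (p%:R ^+ e : Zt) *: g = 0.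
Variable E : 'I_l -> Zt.
Hypothesis evE : forall i j, ur_ev (D i) (E j) = (i == j)%:R.
Local Notation FF j := (ur_field (D j)).
Local Notation annj X F j B := (annihilates (D := D j) (@GP j) (@Ge j) X F B).
Local Notation FT j := {ffun 'I_n.+1 -> G j}.
Local Notation coef j := (inv_coef (FF j) R).

Lemma presents_indicator j X (F : FT j) :
  `[< presents (P j) X F >]%:R = `[< spans F >]%:R *
    \sum_(k < n.+2) \sum_(B : 'M[FF j]_(k, n.+1))
      coef j k * ((row_free B)%:R * `[< annj X F j B >]%:R) :> R.
Proof.
have -> : `[< presents (P j) X F >] = `[< spans F >] && `[< exists A, 
    map_mx (ur_ev (D j)) (mx_subX X) = lat (D j) (@GP j) (@Ge j) F *m A /\
    map_mx (ur_red (D j)) A \in unitmx >].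
  apply/asboolP/andP => [/(presentsP (D j) (@GP j) (@Ge j)) [sF uA]|[/asboolP sF /asboolP uA]].
    by split; apply/asboolP.
  exact/(presentsP (D j) (@GP j) (@Ge j)).
rewrite -mulnb natrM; congr (_ * _).
(* Without a factorisation both sides vanish. Otherwise [A] is unique, so that every test refers to
   the same matrix. *)
have [[A AE]|nA] := pselect (exists A,
  map_mx (ur_ev (D j)) (mx_subX X) = lat (D j) (@GP j) (@Ge j) F *m A); last first.
  have -> : `[< exists A, 
    map_mx (ur_ev (D j)) (mx_subX X) = lat (D j) (@GP j) (@Ge j) F *m A /\
    map_mx (ur_red (D j)) A \in unitmx >] = false.
    by apply/asboolPn => -[A [AE _]]; apply: nA; exists A.
  rewrite big1 // => k _; rewrite big1 // => B _.
  have -> : `[< annj X F j B >] = false by apply/asboolPn => -[A [AE _]]; apply: nA; exists A.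
  by rewrite !mulr0.
have uniqA A' : map_mx (ur_ev (D j)) (mx_subX X) = lat (D j) (@GP j) (@Ge j) F *m A' -> A' = A.
  by rewrite AE => /lat_inj ->.
have -> : `[< exists A, 
    map_mx (ur_ev (D j)) (mx_subX X) = lat (D j) (@GP j) (@Ge j) F *m A /\
    map_mx (ur_red (D j)) A \in unitmx >] = (map_mx (ur_red (D j)) A \in unitmx).
  by apply/asboolP/idP => [[A' [/uniqA ->]]|]; last by exists A.
rewrite unitmx_indicator; apply: eq_bigr => k _; rewrite mulr_sumr big_mkcond.
apply: eq_bigr => B _; case: (row_free B); last by rewrite mul0r mulr0.
rewrite mul1r; congr (_ * _%:R); congr nat_of_bool.
by apply/eqP/asboolP => [BA|[A' [/uniqA ->]]]; first by exists A.
Qed.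

Local Notation FFs := (fprod (fun j : 'I_l => FT j)).
Local Notation KK := (fprod (fun _ : 'I_l => 'I_n.+2)).
Local Notation BB k := (fprod (fun j : 'I_l => 'M[FF j]_(k j, n.+1))).

Definition full_weight (F : FFs) (k : KK) (B : BB k) : R :=
  \prod_j (`[< spans (F j) >]%:R * (coef j (k j) * (row_free (B j))%:R)).

Lemma prod_presents X :
  \prod_j (card_Aut (G j) * `[< cok_iso X (horner_mx X (P j)) (G j) >])%:R =
  \sum_(F : FFs) \sum_(k : KK) \sum_(B : BB k)
    full_weight F B * `[< all_annihilate GP Ge F B X >]%:R :> R.
Proof.
under eq_bigr => j _ do rewrite -card_presents natr_card.
rewrite prod_sum_fprod; apply: eq_bigr => F _ /=.
under eq_bigr => j _ do rewrite presents_indicator mulr_sumr.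
rewrite prod_sum_fprod; apply: eq_bigr => k _.
under eq_bigr => j _ do rewrite mulr_sumr.
rewrite prod_sum_fprod; apply: eq_bigr => B _.
rewrite /all_annihilate asbool_forall_prod -big_split; apply: eq_bigr => j _ /=.
by rewrite !mulrA.
Qed.

Local Notation good F k B :=
  (`[< jointly_spans F >] && `[< jointly_covers (D := D) GP Ge F B >]).

(** The average contribution of a test if the joint maps were onto. The factor for [spans] is
    absent: joint spanning implies it, and without it the sum over [F] factors over j. *)
Definition ideal_weight (k : KK) (B : BB k) : R :=
  \prod_j (coef j (k j) * (row_free (B j))%:R *
    ((#|G j|%:R ^+ n.+1)^-1 * (#|FF j|%:R ^+ (n.+1 * k j))^-1)).

Lemma avg_full_weight (F : FFs) (k : KK) (B : BB k) :
  avg e.+1 (fun X => full_weight F B * `[< all_annihilate GP Ge F B X >]%:R) =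
  ideal_weight B * (good F k B)%:R.
Proof.
rewrite avgZ; case: (boolP (good F k B)) => [/andP[/asboolP sF /asboolP cB]|bad].
  rewrite annihilate_avg // mulr1 /full_weight /ideal_weight -big_split.
  apply: eq_bigr => j _ /=.
  have -> : `[< spans (F j) >] = true.
    apply/asboolP => g.
    (* The target is [g] at index j and 0 elsewhere; the cast transports [g] along the equality of
       indices. *)
    have [v vE] := sF (fun i => if i =P j is ReflectT ij then ecast i (G i) (esym ij) g else 0).
    exists v; rewrite vE; case: eqP => // ij.
    by rewrite (eq_axiomK ij).
  by rewrite mul1r.
rewrite mulr0 /full_weight.
(* For a bad pair either the weight has a zero factor, or all F_j are onto and all B_j have full
   rank; then any X in the event would make the pair good, so the event is empty. *)
have [/forallP sp|/forallPn [j /negPf sj]] :=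
    boolP [forall j, `[< spans (F j) >] && row_free (B j)]; last first.
  rewrite (bigD1 j) //=; move: sj; case: asboolP => _ /=; last by rewrite !mul0r.
  by move=> ->; rewrite !(mulr0, mul0r).
rewrite (_ : avg _ _ = 0) ?mulr0 // -(@avg_cst R p p_prime n e.+1 0); apply: eq_avg => X.
case: asboolP => // ann; case/negP: bad; apply/andP; split; apply/asboolP.
  by apply: (annihilate_spans evE ann) => j; have /andP[/asboolP] := sp j.
by apply: (annihilate_covers evE ann) => j; have /andP[_] := sp j.
Qed.

Definition weighted_count (X : 'M[Zp]_n.+1) : R :=
  \prod_j (card_Aut (G j) * `[< cok_iso X (horner_mx X (P j)) (G j) >])%:R.

Lemma avg_weighted_count : avg e.+1 weighted_count =
  \sum_(F : FFs) \sum_(k : KK) \sum_(B : BB k) ideal_weight B * (good F k B)%:R.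
Proof.
rewrite (eq_avg _ prod_presents) avgE_sum; apply: eq_bigr => F _.
rewrite avgE_sum; apply: eq_bigr => k _; rewrite avgE_sum; apply: eq_bigr => B _.
exact: avg_full_weight.
Qed.

Lemma card_G_neq0 j : #|G j|%:R != 0 :> R.
Proof. by rewrite pnatr_eq0 -lt0n; apply/card_gt0P; exists 0. Qed.

Lemma card_FF_neq0 j : #|FF j|%:R != 0 :> R.
Proof. by rewrite pnatr_eq0 -lt0n; apply/card_gt0P; exists 0. Qed.

(** The sum factors over j. The |G_j|^(n+1) maps F_j cancel the factor |G_j|^-(n+1), and
    [inv_coef_average] evaluates what remains. *)
Lemma sum_ideal_weight :
  \sum_(F : FFs) \sum_(k : KK) \sum_(B : BB k) ideal_weight B =
  \prod_j \prod_(1 <= i < n.+2) (1 - #|FF j|%:R ^- i).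
Proof.
transitivity (\prod_j \sum_(F : FT j) \sum_(k < n.+2) \sum_(B : 'M[FF j]_(k, n.+1))
    (coef j k * (row_free B)%:R *
    ((#|G j|%:R ^+ n.+1)^-1 * (#|FF j|%:R ^+ (n.+1 * k))^-1))).
  rewrite prod_sum_fprod; apply: eq_bigr => F _.
  rewrite prod_sum_fprod; apply: eq_bigr => k _.
  by rewrite prod_sum_fprod.
apply: eq_bigr => j _; rewrite sumr_const card_ffun card_ord -[LHS]mulr_natl natrX mulr_sumr.
rewrite -inv_coef_average; apply: eq_bigr => k _.
rewrite [X in _ = _ * (X / _)]natr_card mulr_suml !mulr_sumr; apply: eq_bigr => B _ /=.
by field; rewrite !expf_neq0 ?card_G_neq0 ?card_FF_neq0.
Qed.

Local Notation gW := (\prod_j (#|G j|%:R ^+ n.+1)^-1 : R).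

Definition abs_weight (k : KK) : R :=
  \prod_j (`|coef j (k j)| * ((#|G j|%:R ^+ n.+1)^-1 * (#|FF j|%:R ^+ (n.+1 * k j))^-1)).

Lemma ideal_weight_le (k : KK) (B : BB k) : `|ideal_weight B| <= abs_weight k.
Proof.
rewrite /ideal_weight normr_prod; apply: ler_prod => j _; rewrite normr_ge0 /=.
rewrite !normrM; case: (row_free _); rewrite ?normr1 ?normr0 ?mulr1 ?mulr0 ?mul0r.
  by rewrite !normfV !normrX !normr_nat.
by rewrite !mulr_ge0 ?invr_ge0 ?exprn_ge0.
Qed.

Lemma card_tests (k : KK) : #|{: BB k}|%:R = \prod_j #|FF j|%:R ^+ (n.+1 * k j) :> R.
Proof.
by rewrite card_fprod natr_prod; apply: eq_bigr => j _; rewrite card_mx natrX mulnC.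
Qed.

Lemma abs_weight_card (k : KK) : abs_weight k * #|{: BB k}|%:R = \prod_j `|coef j (k j)| * gW.
Proof.
rewrite card_tests -!big_split; apply: eq_bigr => j _ /=.
by rewrite -!mulrA mulVf ?mulr1 // expf_neq0 // card_FF_neq0.
Qed.

Lemma sum_coef_expn_le :
  \sum_(k : KK) \prod_j (`|coef j (k j)| * #|FF j|%:R ^+ k j) <= 9 ^+ l.
Proof.
rewrite -(prod_sum_fprod (fun j (k : 'I_n.+2) => `|coef j k| * #|FF j|%:R ^+ k)).
rewrite -[X in _ ^+ X]card_ord -prodr_const; apply: ler_prod => j _.
rewrite inv_coef_bound andbT; apply: sumr_ge0 => k _.
by rewrite mulr_ge0 // exprn_ge0.
Qed.

Lemma sum_coef_le : \sum_(k : KK) \prod_j `|coef j (k j)| <= 9 ^+ l.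
Proof.
apply: le_trans sum_coef_expn_le; apply: ler_sum => k _; apply: ler_prod => j _.
by rewrite normr_ge0 ler_peMr // exprn_ege1 // ler1n; apply/card_gt0P; exists 0.
Qed.

Lemma gW_ge0 : 0 <= gW.
Proof. by apply: prodr_ge0 => j _; rewrite invr_ge0 exprn_ge0. Qed.

Lemma sum_gW : \sum_(F : FFs) gW = 1.
Proof.
rewrite sumr_const -[LHS]mulr_natl card_fprod natr_prod -big_split big1 // => j _ /=.
by rewrite card_ffun card_ord natrX mulfV // expf_neq0 // card_G_neq0.
Qed.

Local Notation wG := (\prod_j #|G j|)%N.

Lemma not_spanning_error :
  \sum_(F : FFs) \sum_(k : KK) \sum_(B : BB k) abs_weight k * `[< ~ jointly_spans F >]%:R
    <= 9 ^+ l * (wG%:R * (1 - wG%:R^-1) ^+ n.+1).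
Proof.
have wG_gt0 : (0 < wG)%N.
  by rewrite prodn_gt0 // => j; apply/card_gt0P; exists 0.
have -> : \sum_(F : FFs) \sum_(k : KK) \sum_(B : BB k) abs_weight k * `[< ~ jointly_spans F >]%:R =
    (\sum_(k : KK) \prod_j `|coef j (k j)|) * (gW * \sum_(F : FFs) `[< ~ jointly_spans F >]%:R).
  rewrite !mulr_sumr; apply: eq_bigr => F _; rewrite mulr_suml; apply: eq_bigr => k _.
  by rewrite sumr_const -[LHS]mulr_natr mulrAC abs_weight_card mulrA.
apply: ler_pM; rewrite ?sumr_ge0 ?sum_coef_le //.
- by move=> k _; apply: prodr_ge0.
- by rewrite mulr_ge0 ?gW_ge0 ?sumr_ge0.
rewrite -natr_card.
have := card_not_spanning n G; rewrite -(ler_nat R) natrM natrX natrB // => h.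
have -> : gW = (wG%:R ^+ n.+1)^-1.
  by rewrite natr_prod -prodrXl -prodfV.
rewrite mulrC ler_pdivrMr ?exprn_gt0 ?ltr0n // -mulrA -exprMn mulrBl mul1r mulVf //.
by rewrite pnatr_eq0 -lt0n.
Qed.

(** The term W/M of [missed_fraction_bound] grows with k, but W is the product of the q_j^(k_j), so
    [sum_coef_expn_le] still bounds its weighted sum by 9^l / M. *)
Lemma not_covering_error m s M : (wG < 2 ^ s)%N -> (m * s <= n.+1)%N -> (0 < M)%N ->
  \sum_(F : FFs) \sum_(k : KK) \sum_(B : BB k)
    abs_weight k * `[< ~ jointly_covers (D := D) GP Ge F B >]%:R
    <= 9 ^+ l * (M%:R * (1 - M%:R^-1) ^+ m + M%:R^-1).
Proof.
move=> Gs ms M0.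
set RHS := (X in _ <= X); apply: (@le_trans _ _ ((\sum_(F : FFs) gW) * RHS)); last first.
  by rewrite sum_gW mul1r.
rewrite mulr_suml; apply: ler_sum => F _; rewrite /RHS.
pose c := M%:R * (1 - M%:R^-1) ^+ m : R.
have c0 : 0 <= c.
  by rewrite mulr_ge0 // exprn_ge0 // subr_ge0 invf_le1 ?ler1n // ltr0n.
apply: (@le_trans _ _ (\sum_(k : KK) gW * (\prod_j `|coef j (k j)| *
   (c + (\prod_j #|FF j|%:R ^+ k j) / M%:R)))).
  apply: ler_sum => k _; rewrite -mulr_sumr -natr_card.
  set bad := #|_|.
  have all_gt0 : 0 < #|{: BB k}|%:R :> R.
    by rewrite card_tests; apply: prodr_gt0 => j _; rewrite exprn_gt0 // lt_def card_FF_neq0 /=.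
  have -> : abs_weight k * bad%:R = gW * (\prod_j `|coef j (k j)| * (bad%:R / #|{: BB k}|%:R)).
    rewrite mulrA [gW * _]mulrC -abs_weight_card -mulrA; congr (_ * _).
    by rewrite mulrC divfK // lt0r_neq0.
  apply: ler_wpM2l; first exact: gW_ge0.
  apply: ler_wpM2l; first exact: prodr_ge0.
  have W_gt0 : (0 < \prod_j #|FF j| ^ k j)%N.
    by rewrite prodn_gt0 // => j; rewrite expn_gt0; apply/orP; left; apply/card_gt0P; exists 0.
  have -> : \prod_j #|FF j|%:R ^+ k j = (\prod_j #|FF j| ^ k j)%:R :> R.
    by rewrite natr_prod; apply: eq_bigr => j _; rewrite natrX.
  apply: missed_fraction_bound => //.
    by rewrite ler_pdivrMr // mul1r ler_nat max_card.
  rewrite mulrAC ler_pdivrMr // -natrX -natrM mulrC -natrX -!natrM ler_nat.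
  exact: card_not_covering Gs ms.
rewrite -mulr_sumr; apply: ler_wpM2l; first exact: gW_ge0.
under eq_bigr => k _ do rewrite mulrDr [X in _ + X]mulrA -big_split /=.
rewrite big_split /= -!mulr_suml mulrDr; apply: lerD.
  by apply: ler_wpM2r => //; exact: sum_coef_le.
by apply: ler_wpM2r; [rewrite invr_ge0|exact: sum_coef_expn_le].
Qed.

Lemma avg_weighted_count_error m s M : (wG < 2 ^ s)%N -> (m * s <= n.+1)%N -> (0 < M)%N ->
  `|avg e.+1 weighted_count - \prod_j \prod_(1 <= i < n.+2) (1 - #|FF j|%:R ^- i)| <=
  9 ^+ l * (wG%:R * (1 - wG%:R^-1) ^+ n.+1 + (M%:R * (1 - M%:R^-1) ^+ m + M%:R^-1)).
Proof.
move=> Gs ms M0; rewrite mulrDr.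
apply: le_trans (lerD not_spanning_error (not_covering_error Gs ms M0)).
rewrite avg_weighted_count -sum_ideal_weight -sumrB -big_split.
apply: le_trans (ler_norm_sum _ _ _) _; apply: ler_sum => F _ /=.
rewrite -sumrB -big_split.
apply: le_trans (ler_norm_sum _ _ _) _; apply: ler_sum => k _ /=.
rewrite -sumrB -big_split.
apply: le_trans (ler_norm_sum _ _ _) _; apply: ler_sum => B _ /=.
rewrite -mulrDr -[X in _ - X]mulr1 -mulrBr normrM.
apply: ler_pM => //; first exact: ideal_weight_le.
by case: asboolP; case: asboolP => // *; rewrite ?subrr ?normr0 ?sub0r ?normrN ?normr1 //;
  case: asboolP; case: asboolP => //= *; rewrite ?addr0 ?add0r ?lerDl ?lexx.
Qed.

End Core.

(** * The limit *)

Lemma monic_irreducible_dvdp (F : fieldType) (f g : {poly F}) : f \is monic -> g \is monic ->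
  irreducible_poly f -> irreducible_poly g -> f %| g -> f = g.
Proof.
move=> fm gm [f1 _] [_ gi] fg; apply/eqP; rewrite -eqp_monic //.
by apply: gi => //; rewrite neq_ltn f1 orbT.
Qed.

(** Chinese remaindering: the product of the other P_i is nonzero in the residue field of S_j, hence
    a unit of S_j, and E_j is that product times a lift of its inverse. *)
Lemma ex_idempotents (p l : nat) (p_prime : prime p) (P : 'I_l -> {poly Zpadic p})
  (D : forall j, unramified (P j)) :
  (forall j, P j \is monic) ->
  (forall j, irreducible_poly (map_poly (@zp_to_Fp p) (P j))) ->
  injective (fun j => map_poly (@zp_to_Fp p) (P j)) ->
  exists E, forall i j, ur_ev (D i) (E j) = (i == j)%:R.
Proof.
move=> P_monic P_irr P_dist.
suff /choice [E hE] : forall j, exists Ej, forall i, ur_ev (D i) Ej = (i == j)%:R.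
  by exists E => i j; rewrite hE.
move=> j; pose Q := \prod_(i | i != j) P i.
have Qj : ur_red (D j) (ur_ev (D j) Q) <> 0.
  apply/eqP; rewrite !rmorph_prod; apply/prodf_neq0 => i ij.
  apply: contra ij => /eqP /ur_evE dv; apply/eqP/P_dist/esym.
  have mon a : map_poly (@zp_to_Fp p) (P a) \is monic :=
    monic_Pb p_prime (P_monic a).
  exact: (monic_irreducible_dvdp (mon j) (mon i) (P_irr j) (P_irr i) dv).
have [s sE] := ur_unit Qj; have [g gE] := ur_ev_surj s.
exists (Q * g) => i; rewrite rmorphM /=.
case: (eqVneq i j) => [->|ij]; first by rewrite gE sE.
rewrite /Q (bigD1 i) //= rmorphM /=.
suff -> : ur_ev (D i) (P i) = 0 by rewrite !mul0r.
by apply/(ur_ev_eq0 (D i)); exists 1; rewrite mulr1.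
Qed.

Lemma common_torsion (p l : nat) (p_prime : prime p) (G : 'I_l -> finLmodType {poly Zpadic p}) :
  exists e, forall j (g : G j), (p%:R ^+ e : {poly Zpadic p}) *: g = 0.
Proof.
have [e eP] := choice (fun j => finite_p_torsion p_prime (G j)).
exists (\sum_j e j)%N => j g.
by rewrite (bigD1 j) //= exprD mulrC -scalerA eP scaler0.
Qed.

Lemma card_Aut_gt0 (A : nzRingType) (G : finLmodType A) : (0 < card_Aut G)%N.
Proof.
apply/card_gt0P; exists [ffun g => g]; rewrite in_setE; apply/asboolP; split.
  by exists id => g; rewrite !ffunE.
by move=> a u v; rewrite !ffunE.
Qed.

Section Limits.
Import numFieldNormedType.Exports.
Variable R : realType.

Lemma cvg_inf_prod (q d : nat) : (0 < q)%N ->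
  (fun N => \prod_(1 <= i < N.+1) (1 - (q%:R : R) ^- (i * d))) @ \oo --> inf_prod R q d.
Proof.
move=> q_gt0.
have fac i : 0 <= 1 - (q%:R : R) ^- (i * d) <= 1.
  have q1 : 1 <= (q%:R : R) ^+ (i * d) by rewrite exprn_ege1 // ler1n.
  have q0 : 0 < (q%:R : R) ^+ (i * d) by apply: lt_le_trans q1.
  by rewrite subr_ge0 invf_le1 // q1 gerBl invr_ge0 ltW.
have ge0 N : 0 <= \prod_(1 <= i < N.+1) (1 - (q%:R : R) ^- (i * d)).
  by apply: prodr_ge0 => i _; case/andP: (fac i).
apply: nonincreasing_is_cvgn; last by exists 0 => _ [N _ <-].
apply/nonincreasing_seqP => N.
by rewrite [X in X <= _]big_nat_recr //= ler_piMr //; case/andP: (fac N.+1).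
Qed.

Lemma cvg_geometric_step (C x : R) (s : nat) : (0 < s)%N -> 0 <= x < 1 ->
  (fun n => C * x ^+ (n %/ s)) @ \oo --> 0.
Proof.
move=> s_gt0 /andP[x0 x1].
have xc : (fun n => C * x ^+ n) @ \oo --> 0.
  rewrite -[X in _ --> X](mulr0 C); apply: cvgM; first exact: cvg_cst.
  by apply: cvg_expr; rewrite ger0_norm.
apply: (cvg_comp (fun n => n %/ s)%N (fun n => C * x ^+ n) _ xc).
move=> A [N _ NA]; exists (N * s)%N => // n /= nN; apply: NA => /=.
by rewrite leq_divRL.
Qed.

(** The cutoff M is chosen first, so that K/M is below eps/2; for this fixed M both geometric terms
    tend to 0 with n. *)
Lemma cvg0_from_bounds (r : nat -> R) (K : R) (wG s : nat) : (0 < wG)%N -> (0 < s)%N ->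
  (forall n M, (0 < M)%N -> `|r n| <= K * (wG%:R * (1 - wG%:R^-1) ^+ n.+1 +
     (M%:R * (1 - M%:R^-1) ^+ (n.+1 %/ s) + M%:R^-1))) ->
  r @ \oo --> 0.
Proof.
move=> wG_gt0 s_gt0 rle.
have inv01 M : (0 < M)%N -> 0 <= 1 - (M%:R : R)^-1 < 1.
  move=> M0; rewrite subr_ge0 invf_le1 ?ltr0n // ler1n M0 /=.
  by rewrite gtrBl invr_gt0 ltr0n.
apply/cvgrPdist_lt => eps eps_gt0.
pose M := (Num.truncn (`|K| * 2 / eps)).+1.
have M0 : (0 < M)%N by [].
have KM : K * M%:R^-1 < eps / 2.
  apply: le_lt_trans (_ : `|K| * M%:R^-1 < _); first by rewrite ler_wpM2r ?ler_norm // invr_ge0.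
  rewrite ltr_pdivrMr ?ltr0n // mulrC -ltr_pdivrMr ?divr_gt0 //.
  by rewrite invf_div mulrA; exact: truncnS_gt.
have c1 : (fun n => K * wG%:R * (1 - wG%:R^-1) ^+ (n.+1 %/ 1)) @ \oo --> (0 : R).
  have := cvg_geometric_step (K * wG%:R) (ltn0Sn 0) (inv01 _ wG_gt0).
  by rewrite -cvg_shiftS.
have c2 : (fun n => K * M%:R * (1 - M%:R^-1) ^+ (n.+1 %/ s)) @ \oo --> (0 : R).
  have := cvg_geometric_step (K * M%:R) s_gt0 (inv01 _ M0).
  by rewrite -cvg_shiftS.
have c3 : (fun n => K * wG%:R * (1 - wG%:R^-1) ^+ (n.+1 %/ 1) +
    K * M%:R * (1 - M%:R^-1) ^+ (n.+1 %/ s)) @ \oo --> (0 : R).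
  by rewrite -[X in _ --> X]addr0; exact: cvgD.
have e2 : 0 < eps / 2 by rewrite divr_gt0.
have c4 := (cvgrPdist_lt _ _).1 c3 _ e2.
case: c4 => N _ c4; exists N => // n /c4 /=.
rewrite !sub0r !normrN divn1 => /(le_lt_trans (ler_norm _)) h.
apply: le_lt_trans (rle n M M0) _.
rewrite !mulrDr !mulrA addrA [X in _ < X](splitr eps); exact: ltrD.
Qed.

End Limits.

Section CokernelLimit.
Import numFieldNormedType.Exports.
Variables (R : realType) (p : nat) (p_prime : prime p) (l : nat).
Variables (P : 'I_l -> {poly Zpadic p}) (D : forall j, unramified (P j)).
Variables (G : 'I_l -> finLmodType {poly Zpadic p}) (e : nat).
Hypothesis GP : forall j (g : G j), P j *: g = 0.
Hypothesis Ge : forall j (g : G j), (p%:R ^+ e : {poly Zpadic p}) *: g = 0.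
Variable E : 'I_l -> {poly Zpadic p}.
Hypothesis evE : forall i j, ur_ev (D i) (E j) = (i == j)%:R.

Definition all_cok_iso n (X : 'M[Zpadic p]_n.+1) :=
  forall j : 'I_l, cok_iso X (horner_mx X (P j)) (G j).

Lemma all_cok_iso_periodic n (X Z : 'M[Zpadic p]_n.+1) :
  all_cok_iso (X + p%:R ^+ e.+1 *: Z) <-> all_cok_iso X.
Proof.
by split=> h j; apply/cok_isoP; have /cok_isoP [F FP] := h j; exists F;
  apply/(presents_periodic (D j) (@GP j) (@Ge j) _ Z).
Qed.

Lemma weighted_countE n (X : 'M[Zpadic p]_n.+1) : weighted_count R P G X =
  \prod_j (card_Aut (G j))%:R * `[< all_cok_iso X >]%:R.
Proof.
rewrite asbool_forall_prod -big_split; apply: eq_bigr => j _.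
by rewrite natrM.
Qed.

Lemma cvg_cok_probability :
  (fun n => avg e.+1 (fun X : 'M[Zpadic p]_n.+1 => `[< all_cok_iso X >]%:R)) @ \oo -->
  \prod_j ((card_Aut (G j))%:R^-1 * inf_prod R p (size (P j)).-1).
Proof.
pose Pi n : R := \prod_j \prod_(1 <= i < n.+2) (1 - #|ur_field (D j)|%:R ^- i).
pose r n := avg e.+1 (@weighted_count R p n l P G) - Pi n.
pose wG := (\prod_j #|G j|)%N.
have wG_gt0 : (0 < wG)%N by rewrite prodn_gt0 // => j; apply/card_gt0P; exists 0.
have r0 : r @ \oo --> (0 : R).
  (* Blocks of length [wG] suffice for the pigeonhole since wG < 2^wG, and n + 1 coordinates contain
     (n + 1) %/ wG of them. *)
  apply: (@cvg0_from_bounds _ _ (9 ^+ l) wG wG) => // n M M0.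
  rewrite /r /Pi /wG; exact: (@avg_weighted_count_error R p p_prime n l P D G e GP Ge E evE _ wG M
    (ltn_expl wG (ltnSn 1)) (leq_divM n.+1 wG) M0).
have PiL : Pi @ \oo --> (\prod_j inf_prod R p (size (P j)).-1 : R).
  apply: cvg_big => [|j _]; first exact: mul_continuous.
  rewrite (_ : (fun n => _) =
      fun n => \prod_(1 <= i < n.+2) (1 - (p%:R : R) ^- (i * (size (P j)).-1))).
    by have := @cvg_inf_prod R p (size (P j)).-1 (prime_gt0 p_prime); rewrite -cvg_shiftS.
  apply: funext => n; apply: eq_bigr => i _.
  by rewrite ur_card natrX -exprM mulnC.
have Aut0 : \prod_j (card_Aut (G j))%:R != 0 :> R.
  by apply/prodf_neq0 => j _; rewrite pnatr_eq0 -lt0n card_Aut_gt0.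
rewrite big_split /= prodfV.
have -> : (fun n => avg e.+1 (fun X : 'M[Zpadic p]_n.+1 => `[< all_cok_iso X >]%:R)) =
    (fun n => (\prod_j (card_Aut (G j))%:R)^-1 * (r n + Pi n)).
  apply: funext => n; rewrite /r subrK (eq_avg _ (@weighted_countE n)) avgZ.
  by rewrite mulrA mulVf // mul1r.
apply: cvgM; first exact: cvg_cst.
by rewrite -[X in _ --> X]add0r; exact: cvgD.
Qed.

End CokernelLimit.

Theorem theorem1p1 (R : realType) (p : nat) (hp : prime p) (l : nat)
  (P : 'I_l -> {poly Zpadic p})
  (P_monic : forall j, P j \is monic)
  (P_deg : forall j, (size (P j) <= 3)%N)
  (P_irr : forall j, irreducible_poly (map_poly (@zp_to_Fp p) (P j)))
  (P_dist : injective (fun j => map_poly (@zp_to_Fp p) (P j)))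
  (G : 'I_l -> finLmodType {poly Zpadic p})
  (G_mod : forall j (g : G j), P j *: g = 0)
  (mu : forall n : nat, probability (MatZp p n) R)
  (mu_haar : forall n : nat, is_haar (mu n)) :
  (fun n : nat =>
     mu n.+1 [set X : MatZp p n.+1 |
                forall j : 'I_l, cok_iso X (horner_mx X (P j)) (G j)])
    @ \oo -->
  ((\prod_(j < l) ((card_Aut (G j))%:R^-1 * inf_prod R p (size (P j)).-1))%:E)%E.
Proof.
pose D j := unramified_qpoly hp (P_monic j) (P_irr j).
have [E evE] := ex_idempotents hp D P_monic P_irr P_dist.
have [e Ge] := common_torsion hp G.
have -> : (fun n : nat => mu n.+1 [set X : MatZp p n.+1 |
    forall j : 'I_l, cok_iso X (horner_mx X (P j)) (G j)]) =
  (fun n => (avg e.+1 (fun X : 'M[Zpadic p]_n.+1 => `[< all_cok_iso P G X >]%:R))%:E).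
  apply: funext => n; apply: (haar_periodic hp (mu_haar n.+1)) => X Z.
  exact: (all_cok_iso_periodic D G_mod Ge).
apply: cvg_EFin; first by apply: nearW.
exact: (cvg_cok_probability hp G_mod Ge evE).
Qed.
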